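(* There exists a constant $c>0$ such that, if $G$ is a uniformly random $3$-regular graph on $n$ vertices ($n$ even), then asymptotically almost surely (that is, with probability tending to $1$ as $n\to\infty$) we have $\mathcal{D}(G,\mathcal{T}_n)\ge cn$; i.e. for every labeling $f:E(G)\to\{-1,1\}$ there is a spanning tree $T$ of $G$ with $\left|\sum_{e\in E(T)}f(e)\right|\ge cn$.
   Context: $\mathcal{G}_{n,3}$ denotes the set of simple $3$-regular graphs on the vertex set $\{1,\dots,n\}$ with the uniform probability measure (nonempty only for even $n\geq 4$). For a graph $G$, a family $\mathcal{S}_G$ of subgraphs of $G$ and $f:E(G)\to\{-1,1\}$, put $f(S)=\sum_{e\in E(S)}f(e)$ for $S\in\mathcal{S}_G$; the discrepancy is $\mathcal{D}(G,\mathcal{S}_G)=\min_f\max_{S\in\mathcal{S}_G}|f(S)|$, the minimum being over all $f:E(G)\to\{-1,1\}$. $\mathcal{T}_n$ is the set of spanning trees of $G$. *)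

(* Defs.v *)
From mathcomp Require Import all_boot all_order all_algebra.

Set Implicit Arguments.
Unset Strict Implicit.
Unset Printing Implicit Defensive.

Import Order.TTheory GRing.Theory Num.Theory.
Local Open Scope ring_scope.

(* A pair (vertex set, edge set); the pairs that really are finite simple graphs
   are singled out by [simple_graph]. Subgraphs live in the same type. *)
Notation graph V := ({set V} * {set {set V}})%type.

Section Graphs.
Variable V : finType.
Implicit Types G H T : graph V.

Definition verts G : {set V} := G.1.
Definition edges G : {set {set V}} := G.2.

Definition simple_graph G : bool :=
  [forall e in edges G, (#|e| == 2%N) && (e \subset verts G)].

Definition degree G (v : V) : nat := #|[set e in edges G | v \in e]|.

Definition regular_graph (k : nat) G : bool :=
  [forall v in verts G, degree G v == k].

Definition subgraph H G : bool :=
  [&& simple_graph H, verts H \subset verts G & edges H \subset edges G].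

Definition adj G : rel V := fun x y => [set x; y] \in edges G.

Definition connected_graph G : bool :=
  (verts G != set0) &&
  [forall x in verts G, forall y in verts G, connect (adj G) x y].

(* A cycle has pairwise distinct vertices, hence at most #|V| of them; bounding
   its length only serves to make the predicate boolean. *)
Definition acyclic_graph G : bool :=
  [forall k : 'I_#|V|.+1, forall p : k.-tuple V,
     (2 < k)%N ==> ~~ (cycle (adj G) p && uniq p)].

Definition tree T : bool := [&& simple_graph T, connected_graph T & acyclic_graph T].

Definition spanning_trees G : {set graph V} :=
  [set T | [&& subgraph T G, verts T == verts G & tree T]].

Definition edge G := {e : {set V} | e \in edges G}.

(* A labeling E(G) -> {-1, 1} is encoded by f : {ffun edge G -> bool}, the label
   of e being (-1) ^+ f e. *)
Definition labeling G := {ffun edge G -> bool}.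

Definition label_sum G (f : labeling G) (S : graph V) : int :=
  \sum_(e : edge G | val e \in edges S) (-1) ^+ f e.

(* The maximum over an empty family is 0. *)
Definition max_label_sum G (F : {set graph V}) (f : labeling G) : nat :=
  \max_(S in F) `|label_sum f S|%N.

(* The starting point of [arg min] is irrelevant: the minimum ranges over all
   labelings. *)
Definition discrepancy G (F : {set graph V}) : nat :=
  max_label_sum F
    [arg min_(f < [ffun=> false] : labeling G) max_label_sum F f]%N.

End Graphs.

Definition regular_graphs (n k : nat) : {set graph 'I_n} :=
  [set G | [&& simple_graph G, verts G == [set: 'I_n] & regular_graph k G]].

Definition uniform_prob_of (R : numFieldType) (T : finType) (A : {set T})
    (P : pred T) : R :=
  #|[set x in A | P x]|%:R / #|A|%:R.

(* Main.v *)
Require Import Defs.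
From mathcomp Require Import all_boot all_order all_algebra.
From mathcomp Require Import zify ring lra.

(* If the subgraph R of edges of one label has c(R) components, then some
   spanning tree contains n - c(R) edges of R, so its label sum is at least
   n - 2 c(R) in absolute value.  If all label sums were o(n), both colour
   classes would have about n/2 components.  A component C of R either is large,
   or is small with at most |C| + 1 outgoing edges in G, or sends out at least
   |C| + 2 edges of the other class B, and in the last case it is paid for by its
   share of sum_v (deg_B v - 1)^+ / 2.  When the first two kinds are rare, adding both
   colours shows that almost all vertices are monochromatic, about half of them
   in each colour; but no edge joins vertices of opposite colours, which
   contradicts the expansion of G.

   The facts needed about G are obtained by one switching: for a fixed vertex
   set A, exchanging an edge inside A and an edge outside A for two edges across
   compares the number of cubic graphs with b and with b + 2 edges between A and
   its complement.  Iterating the comparison and summing over A shows that, with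
   probability 1 - O(1/n), G is connected, sets of size between n/4 and n/2 have
   linear boundary, and o(n) small sets A have at most |A| + 1 outgoing edges. *)

Set Implicit Arguments.
Unset Strict Implicit.
Unset Printing Implicit Defensive.

Import Order.TTheory GRing.Theory Num.Theory.

(** * Switchings across a cut *)

Section CubicGraphs.
Variable V : finType.
Implicit Types (E F : {set {set V}}) (A C : {set V}) (e : {set V}) (x y v : V).

Definition graphic E : bool := [forall e in E, #|e : {set V}| == 2].

Definition cubic : {set {set {set V}}} :=
  [set E : {set {set V}} | graphic E && [forall v, #|[set e in E | v \in (e : {set V})]| == 3]].

Definition nbhd E x : {set V} := [set y | [set x; y] \in E].

(** Crossing edges are oriented out of [A], so each is counted exactly once. *)
Definition cut E A : {set V * V} :=
  [set p | [&& p.1 \in A, p.2 \notin A & [set p.1; p.2] \in E]].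

Lemma cubic_graphic E : E \in cubic -> graphic E.
Proof. by rewrite inE => /andP[]. Qed.

Lemma cubic_card2 E e : E \in cubic -> e \in E -> #|e| = 2.
Proof. by move=> /cubic_graphic/forall_inP h /h/eqP. Qed.

Lemma graphic_neq E x y : graphic E -> [set x; y] \in E -> x != y.
Proof. by move=> /forall_inP h /h; rewrite cards2; case: (x == y). Qed.

Lemma cubic_neq E x y : E \in cubic -> [set x; y] \in E -> x != y.
Proof. by move=> /cubic_graphic; apply: graphic_neq. Qed.

Lemma card_nbhd_incident E x : graphic E ->
  #|nbhd E x| = #|[set e in E | x \in (e : {set V})]|.
Proof.
move=> gE; rewrite -(@card_in_imset _ _ (fun y => [set x; y])); last first.
  move=> y z; rewrite !inE => hy hz /setP/(_ y); rewrite !inE eqxx orbT.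
  by move/esym/orP => [/eqP h|/eqP//]; have := graphic_neq gE hy; rewrite h eqxx.
apply: eq_card => e; rewrite !inE; apply/imsetP/andP.
  by move=> [y]; rewrite inE => hy ->; rewrite hy !inE eqxx.
move=> [he xe]; have /cards2P[a [b [ab ee]]] := forall_inP gE _ he.
move: xe; rewrite ee !inE => /orP[/eqP->|/eqP->].
  by exists b => //; rewrite inE -ee.
by exists a; rewrite ?inE setUC -?ee.
Qed.

Lemma card_nbhd E x : E \in cubic -> #|nbhd E x| = 3.
Proof.
move=> hE; rewrite card_nbhd_incident ?cubic_graphic //.
by move: hE; rewrite inE => /andP[_ /forallP/(_ x)/eqP].
Qed.

Lemma card_incident_pairs E A : E \in cubic ->
  #|[set p : V * V | (p.1 \in A) && ([set p.1; p.2] \in E)]| = 3 * #|A|.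
Proof.
move=> hE; rewrite -sum1dep_card -(pair_big_dep (mem A) (fun x y => [set x; y] \in E) (fun _ _ => 1)) /=.
rewrite (eq_bigr (fun _ => 3)); first by rewrite sum_nat_const mulnC.
move=> x _; rewrite -(card_nbhd x hE) -sum1_card; apply: eq_bigl => y.
by rewrite inE.
Qed.

Lemma card_cutC E A : #|cut E (~: A)| = #|cut E A|.
Proof.
pose sw (p : V * V) := (p.2, p.1).
have sw_inj : injective sw by move=> [a b] [c d] [-> ->].
rewrite -(card_imset _ sw_inj); apply: eq_card => -[a b]; rewrite inE /=.
apply/imsetP/and3P => [[[c d]] | [ha hb hab]].
  by rewrite !inE negbK => /and3P[h1 h2 h3] [-> ->]; rewrite setUC.
by exists (b, a); rewrite // !inE /= negbK ha hb setUC.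
Qed.

Definition inner E A : {set V * V} :=
  [set p | [&& p.1 \in A, p.2 \in A & [set p.1; p.2] \in E]].

(** Degree sum over [A]: an edge inside [A] is counted from both of its ends, a crossing edge from
    one. *)
Lemma card_inner E A : E \in cubic -> #|inner E A| + #|cut E A| = 3 * #|A|.
Proof.
move=> hE; rewrite -(card_incident_pairs A hE) -cardsUI.
have -> : inner E A :&: cut E A = set0.
  by apply/setP=> p; rewrite !inE; case: (p.2 \in A); rewrite ?andbF.
rewrite cards0 addn0; apply: eq_card => p; rewrite !inE.
by case: (p.1 \in A); case: (p.2 \in A) => //=; rewrite ?orbF.
Qed.

(* For [p = (x, x')] and [p' = (y, y')], the edges xy and x'y' are exchanged for
   xx' and yy'; the pairs are grouped so that [p] and [p'] are the new edges
   across the cut. *)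
Definition switch E (p p' : V * V) : {set {set V}} :=
  [set p.1; p.2] |: ([set p'.1; p'.2] |:
    (E :\ [set p.1; p'.1] :\ [set p.2; p'.2])).

(** Here [q.1] and [q.2] are the future crossing edges; their absence from [E] keeps the switched
    graph simple. As inner edges are oriented, both ways of reconnecting two given edges occur. *)
Definition switchable E A : {set (V * V) * (V * V)} :=
  [set q | [&& (q.1.1, q.2.1) \in inner E A, (q.1.2, q.2.2) \in inner E (~: A),
             [set q.1.1; q.1.2] \notin E & [set q.2.1; q.2.2] \notin E]].

(** Two distinct absent edges replace two distinct present ones. The weight [f] is arbitrary so that
    incidence with a fixed vertex can be inserted, which shows that switching preserves degrees. *)
Lemma big_switch E A q (f : {set V} -> nat) : E \in cubic -> q \in switchable E A ->
  \sum_(e in switch E q.1 q.2) f e + (f [set q.1.1; q.2.1] + f [set q.1.2; q.2.2])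
  = \sum_(e in E) f e + (f [set q.1.1; q.1.2] + f [set q.2.1; q.2.2]).
Proof.
case: q => -[x x'] [y y'] hE; rewrite !inE /=.
move=> /andP[/and3P[hx hy hxy] /andP[/and3P[hx' hy' hxy'] /andP[nxx nyy]]].
have n1 : x != y by exact: cubic_neq hxy.
rewrite /switch /= big_setU1 /=; last first.
  rewrite !inE (negbTE nxx) !andbF orbF.
  apply/eqP => /setP/(_ x); rewrite !inE eqxx (negbTE n1) /= => /esym/eqP h.
  by rewrite -h hx in hy'.
rewrite big_setU1 /=; last by rewrite !inE (negbTE nyy) !andbF.
rewrite (big_setD1 _ hxy) /= [in RHS](big_setD1 [set x'; y']) /=; first by set S := (\sum_(i in _ :\ _) f i); move: S => S; ring.
rewrite !inE hxy' andbT.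
apply/eqP => /setP/(_ x); rewrite !inE eqxx /= => /orP[]/eqP h.
  by rewrite -h hx in hx'.
by rewrite -h hx in hy'.
Qed.

Lemma switch_cubic E A q : E \in cubic -> q \in switchable E A ->
  switch E q.1 q.2 \in cubic.
Proof.
move=> hE hq; rewrite inE; apply/andP; split.
  case: q hq => -[x x'] [y y']; rewrite !inE /=.
  move=> /andP[/and3P[hx hy hxy] /andP[/and3P[hx' hy' hxy'] /andP[nxx nyy]]].
  apply/forall_inP => e; rewrite !inE /= => /or3P[/eqP->|/eqP->|].
  - by rewrite cards2 (memPn hx' _ hx).
  - by rewrite cards2 (memPn hy' _ hy).
  by move=> /and3P[_ _ /(cubic_card2 hE) ->].
apply/forallP => v; apply/eqP.
have := hE; rewrite inE => /andP[_ /forallP/(_ v)/eqP].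
have cE F : #|[set e in F | v \in e]| = \sum_(e in F) (v \in e).
  rewrite -sum1dep_card big_mkcondr.
  by apply: eq_bigr => e _; case: (v \in e).
rewrite !cE => <-; have /= := big_switch (fun e => v \in e : nat) hE hq.
move=> hs.
have h2 a b : a != b -> (v \in [set a; b]) = (v == a) + (v == b) :> nat.
  by rewrite !inE => ab; case: (eqVneq v a) => [->|]; rewrite ?(negbTE ab).
case: q hq hs => -[x x'] [y y']; rewrite inE /= [_ \in inner _ _]inE [_ \in inner _ (~: A)]inE /=.
move=> /and4P[/and3P[hx hy hxy] /and3P[]].
rewrite ![_ \in ~: A]inE => hx' hy' hxy' nxx nyy hs.
rewrite !h2 /= ?(memPn hx' _ hx) ?(memPn hy' _ hy) ?(cubic_neq hE hxy) ?(cubic_neq hE hxy') // in hs.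
by rewrite addnACA in hs; apply: addIn hs.
Qed.

Lemma cut_switch E A q : E \in cubic -> q \in switchable E A ->
  [/\ q.1 \in cut (switch E q.1 q.2) A, q.2 \in cut (switch E q.1 q.2) A,
      q.2 != q.1 & #|cut (switch E q.1 q.2) A| = #|cut E A|.+2].
Proof.
case: q => -[x x'] [y y'] hE; rewrite inE /= [_ \in inner _ _]inE [_ \in inner _ (~: A)]inE /=.
move=> /and4P[/and3P[hx hy hxy] /and3P[]].
rewrite ![_ \in ~: A]inE => hx' hy' hxy' nxx nyy.
have n1 : y != x by rewrite eq_sym (cubic_neq hE hxy).
split; rewrite ?inE /= ?hx ?hx' ?hy ?hy' /switch ?inE ?eqxx ?orbT//.
  by rewrite xpair_eqE (negbTE n1).
have -> : cut ([set x; x'] |: ([set y; y'] |: (E :\ [set x; y] :\ [set x'; y']))) A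
   = (x, x') |: ((y, y') |: cut E A).
  apply/setP => -[a b]; rewrite !inE /= !xpair_eqE.
  case ha: (a \in A) => /=; last first.
    have na u : u \in A -> (a == u) = false.
      by move=> hu; apply: contraFF ha => /eqP->.
    by rewrite !na.
  case hb: (b \in A) => /=.
    have nb u : u \notin A -> (b == u) = false.
      by move=> hu; apply: contraNF hu => /eqP<-.
    by rewrite !nb // !andbF.
  have e2 u w : u \in A -> w \notin A -> ([set a; b] == [set u; w]) = (a == u) && (b == w).
    move=> hu hw; apply/eqP/andP => [/setP h|[/eqP->/eqP->]//].
    have := h a; rewrite !inE eqxx /= => /esym/orP[/eqP au|/eqP au]; last first.
      by rewrite -au ha in hw.
    have := h b; rewrite !inE eqxx orbT => /esym/orP[/eqP bu|/eqP->]; last by rewrite au !eqxx.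
    by rewrite bu hu in hb.
  rewrite (e2 x x') // (e2 y y') //.
  case: (_ && _) => //=; case: (_ && _) => //=.
  have -> : ([set a; b] == [set x'; y']) = false.
    apply/eqP => /setP/(_ a); rewrite !inE eqxx /= => /esym/orP[]/eqP h;
    by rewrite -h ha in hx' hy'.
  have -> : ([set a; b] == [set x; y]) = false.
    apply/eqP => /setP/(_ b); rewrite !inE eqxx orbT => /esym/orP[]/eqP h;
    by rewrite h ?hx ?hy in hb.
  by [].
by rewrite !cardsU1 !inE /= xpair_eqE [x == y]eq_sym (negbTE n1) (negbTE nxx) (negbTE nyy) !andbF.
Qed.

(** Knowing [q], the switching is undone by deleting the two new edges and restoring the two old
    ones. *)
Lemma switch_inj E F A q : q \in switchable E A -> q \in switchable F A ->
  switch E q.1 q.2 = switch F q.1 q.2 -> E = F.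
Proof.
case: q => -[x x'] [y y']; rewrite inE /= [_ \in inner _ _]inE [_ \in inner _ (~: A)]inE /=.
move=> /and4P[/and3P[hx hy hxy] /and3P[hx' hy' hxy'] nxx nyy].
rewrite inE /= [_ \in inner _ _]inE [_ \in inner _ (~: A)]inE /=.
move=> /and4P[/and3P[_ _ fxy] /and3P[_ _ fxy'] mxx myy].
move=> /setP h; apply/setP => e; have := h e; rewrite !inE /=.
case: (eqVneq e [set x; y]) => [->|_]; first by rewrite hxy fxy.
case: (eqVneq e [set x'; y']) => [->|_]; first by rewrite hxy' fxy'.
case: (eqVneq e [set x; x']) => [->|_]; first by rewrite (negbTE nxx) (negbTE mxx).
by case: (eqVneq e [set y; y']) => [->|_]; first by rewrite (negbTE nyy) (negbTE myy).
Qed.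


Lemma card_adjacent_to_cut E A : E \in cubic ->
  #|[set q : (V * V) * (V * V) | [&& q.1 \in cut E A, q.2.1 \in nbhd E q.1.1
                                   & q.2.2 \in nbhd E q.1.2]]| = 9 * #|cut E A|.
Proof.
move=> hE; rewrite -sum1dep_card.
rewrite -(pair_big_dep (mem (cut E A)) (fun p p' : V * V =>
   (p'.1 \in nbhd E p.1) && (p'.2 \in nbhd E p.2)) (fun _ _ => 1)) /=.
rewrite (eq_bigr (fun _ => 9)); first by rewrite sum_nat_const mulnC.
move=> p _; rewrite sum1dep_card -[9]/(3 * 3) -{1}(card_nbhd p.1 hE).
by rewrite -(card_nbhd p.2 hE) -cardsX; apply: eq_card => p'; rewrite !inE.
Qed.

(** The product counts all choices of an oriented edge on each side. A choice fails only if one of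
    the two new pairs is already a crossing edge; given that edge, 3 * 3 choices remain for the
    other two ends, whence the error term 2 * 9 per crossing edge. *)
Lemma card_switchable E A : E \in cubic ->
  (3 * #|A| - #|cut E A|) * (3 * #|~: A| - #|cut E A|)
    <= #|switchable E A| + 18 * #|cut E A|.
Proof.
move=> hE.
have i1 := card_inner A hE; have i2 := card_inner (~: A) hE.
rewrite card_cutC in i2; rewrite -{1}i1 -{1}i2 !addnK.
pose g (q : (V * V) * (V * V)) := ((q.1.1, q.2.1), (q.1.2, q.2.2)).
have g_inj : injective g.
  by move=> [[a b] [c d]] [[a' b'] [c' d']] [-> -> -> ->].
pose sw (q : (V * V) * (V * V)) := (q.2, q.1).
have sw_inj : injective sw by move=> [a b] [c d] [-> ->].
rewrite -cardsX -(card_imset _ g_inj).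
set B := [set q : (V * V) * (V * V) | [&& q.1 \in cut E A, q.2.1 \in nbhd E q.1.1
                                   & q.2.2 \in nbhd E q.1.2]].
have cB : #|B| = 9 * #|cut E A| by exact: card_adjacent_to_cut.
have -> : 18 * #|cut E A| = #|B| + #|sw @: B|.
  by rewrite (card_imset _ sw_inj) cB -mulnDl.
have /subset_leq_card : g @: setX (inner E A) (inner E (~: A)) \subset
  switchable E A :|: (B :|: sw @: B).
  apply/subsetP => z /imsetP[[[x y] [x' y']] /setXP[h1 h2] ->]; move: h1 h2.
  rewrite /= !inE /= => /and3P[hx hy hxy] /and3P[hx' hy' hxy'].
  rewrite hx hy hx' hy' hxy hxy' /=.
  case hxx: ([set x; x'] \in E) => //=.
  case hyy: ([set y; y'] \in E) => //=.
  apply/imsetP; exists ((y, y'), (x, x')) => //.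
  by rewrite !inE /= hy hy' hyy setUC hxy setUC hxy'.
move=> h; apply: leq_trans h _; apply: leq_trans (leq_card_setU _ _) _.
by rewrite leq_add2l leq_card_setU.
Qed.

Definition cubic_cut A (b : nat) : {set {set {set V}}} :=
  [set E in cubic | #|cut E A| == b].

(** Double counting of switchings from [b] to [b + 2] crossing edges. The source side is bounded
    below by [card_switchable]; on the target side a switching is determined by the new graph and an
    ordered pair of distinct crossing edges. *)
Lemma switching A (b : nat) :
  #|cubic_cut A b| * ((3 * #|A| - b) * (3 * #|~: A| - b))
    <= #|cubic_cut A b| * (18 * b) + #|cubic_cut A b.+2| * (b.+2 * b.+1).
Proof.
pose S1 := [set z : {set {set V}} * ((V * V) * (V * V)) |
  (z.1 \in cubic_cut A b) && (z.2 \in switchable z.1 A)].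
pose S2 := [set z : {set {set V}} * ((V * V) * (V * V)) |
  (z.1 \in cubic_cut A b.+2) &&
  [&& z.2.1 \in cut z.1 A, z.2.2 \in cut z.1 A & z.2.2 != z.2.1]].
have c1 : #|cubic_cut A b| * ((3 * #|A| - b) * (3 * #|~: A| - b))
    <= #|cubic_cut A b| * (18 * b) + #|S1|.
  rewrite -[#|S1|]sum1dep_card -(pair_big_dep (mem (cubic_cut A b))
    (fun E q => q \in switchable E A) (fun _ _ => 1)) /=.
  rewrite -!sum_nat_const -big_split /=; apply: leq_sum => E.
  rewrite inE => /andP[hE /eqP cE].
  by rewrite sum1_card addnC -{1 2 3}cE card_switchable.
have c2 : #|S2| = #|cubic_cut A b.+2| * (b.+2 * b.+1).
  rewrite -[#|S2|]sum1dep_card -(pair_big_dep (mem (cubic_cut A b.+2))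
    (fun E q => [&& q.1 \in cut E A, q.2 \in cut E A & q.2 != q.1]) (fun _ _ => 1)) /=.
  rewrite -sum_nat_const; apply: eq_bigr => E.
  rewrite inE => /andP[hE /eqP cE].
  rewrite -(pair_big_dep (mem (cut E A))
    (fun p p' => (p' \in cut E A) && (p' != p)) (fun _ _ => 1)) /=.
  rewrite -cE -[in RHS]sum_nat_const; apply: eq_bigr => p hp.
  rewrite -[RHS]/(b.+2.-1) -cE (cardsD1 p) hp /= -sum1_card.
  by apply: eq_bigl => p'; rewrite !inE andbC.
apply: leq_trans c1 _; rewrite leq_add2l -c2.
pose phi (z : {set {set V}} * ((V * V) * (V * V))) := (switch z.1 z.2.1 z.2.2, z.2).
have phi_inj : {in S1 &, injective phi}.
  move=> [E q] [F r] hz hw [eEF eqr].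
  have hE : q \in switchable E A by move: hz; rewrite inE => /andP[].
  have hF : r \in switchable F A by move: hw; rewrite inE => /andP[].
  by rewrite -eqr in hF eEF *; rewrite (switch_inj hE hF eEF).
rewrite -(card_in_imset phi_inj); apply: subset_leq_card.
apply/subsetP => _ /imsetP[[E q] + ->].
rewrite inE [_ \in cubic_cut _ _]inE /= => /andP[/andP[hE /eqP cE] hq].
have [h1 h2 h3 h4] := cut_switch hE hq.
by rewrite inE /= h1 h2 h3 inE (switch_cubic hE hq) h4 cE eqxx.
Qed.

End CubicGraphs.

(** * Components and forests *)

Section Components.
Variable V : finType.
Implicit Types (E F T : {set {set V}}) (A C : {set V}) (x y z v : V).

Lemma set2_inj x y z v : [set x; y] = [set z; v] ->
  (x = z /\ y = v) \/ (x = v /\ y = z).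
Proof.
move=> /setP h; have := h z; have := h v; have := h x; have := h y.
rewrite !inE !eqxx !orbT /= => /esym/orP[]/eqP ? /esym/orP[]/eqP ? /orP[]/eqP ? /orP[]/eqP ?; subst; auto.
Qed.

Definition linked E : rel V := connect (adj ([set: V], E)).

(** Written as a block of [equivalence_partition], so that [equivalence_partitionP] applies to
    [components]. *)
Definition component E x : {set V} := [set y in [set: V] | linked E x y].

Definition components E : {set {set V}} := [set component E x | x in [set: V]].

Lemma linked_sym E x y : linked E x y = linked E y x.
Proof. by apply: sym_connect_sym => a b; rewrite /adj setUC. Qed.

Lemma linked_trans E : transitive (linked E).
Proof. exact: connect_trans. Qed.

Lemma linked_refl E x : linked E x x.
Proof. exact: connect0. Qed.

Lemma linked_edge E x y : [set x; y] \in E -> linked E x y.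
Proof. by move=> h; apply: connect1. Qed.

Lemma linked_equiv E : {in [set: V] & &, equivalence_rel (linked E)}.
Proof.
move=> x y z _ _ _; split; first exact: linked_refl.
move=> xy; apply/idP/idP; apply: linked_trans => //.
by rewrite linked_sym.
Qed.

Lemma in_component E x y : (y \in component E x) = linked E x y.
Proof. by rewrite !inE. Qed.

Lemma eq_component E x y : (component E x == component E y) = linked E x y.
Proof.
apply/eqP/idP => [h|h]; first by rewrite -in_component h in_component linked_refl.
by apply/setP => z; rewrite !in_component; have [_ ->] := linked_equiv E (in_setT x) (in_setT y) (in_setT z).
Qed.

Lemma components_partition E : partition (components E) [set: V].
Proof. exact: (equivalence_partitionP (@linked_equiv E)). Qed.

Lemma linked_subset E F : (forall x y, [set x; y] \in E -> linked F x y) ->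
  forall x y, linked E x y -> linked F x y.
Proof. by move=> h; apply: connect_sub => x y; apply: h. Qed.

Lemma eq_components E F : linked E =2 linked F -> components E = components F.
Proof.
move=> h; apply: eq_imset => x; apply/setP => y; by rewrite !in_component h.
Qed.

Lemma linked_add E x y a b : linked ([set x; y] |: E) a b =
  [|| linked E a b, linked E a x && linked E y b | linked E a y && linked E x b].
Proof.
apply/idP/idP => [|h]; last first.
  have sub u w : linked E u w -> linked ([set x; y] |: E) u w.
    by apply: linked_subset => c d h'; apply: linked_edge; rewrite !inE h' orbT.
  have xy : linked ([set x; y] |: E) x y by apply: linked_edge; rewrite !inE eqxx.
  case/or3P: h => [/sub//|/andP[/sub h1 /sub h2]|/andP[/sub h1 /sub h2]].
    exact: linked_trans (linked_trans h1 xy) h2.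
  by rewrite linked_sym in xy; exact: linked_trans (linked_trans h1 xy) h2.
case/connectP => p; elim/last_ind: p b => [|p c IH] b /=.
  by move=> _ ->; rewrite linked_refl.
rewrite rcons_path last_rcons => /andP[/IH{}IH + ->].
have {IH} := IH _ erefl; set d := last a p => IH.
rewrite /adj inE => /orP[|/linked_edge dc]; last first.
  case/or3P: IH => [h1|/andP[-> h1]|/andP[-> h1]]; rewrite (linked_trans h1 dc) ?orbT //=.
rewrite inE => /eqP/set2_inj[][hd ->]; rewrite {}hd in IH.
  by case/or3P: IH => [->|/andP[->]|/andP[->]]; rewrite ?linked_refl ?orbT.
by case/or3P: IH => [->|/andP[->]|/andP[->]]; rewrite ?linked_refl ?orbT.
Qed.

Lemma linked_add_redundant E x y : linked E x y ->
  linked ([set x; y] |: E) =2 linked E.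
Proof.
move=> xy a b; rewrite linked_add; have yx := xy; rewrite linked_sym in yx.
apply/or3P/idP => [[//|/andP[h1 h2]|/andP[h1 h2]]|->]; last by constructor.
  exact: linked_trans (linked_trans h1 xy) h2.
exact: linked_trans (linked_trans h1 yx) h2.
Qed.

(** The components of [x] and [y] merge into the single block [U], and all other blocks are
    unchanged. *)
Lemma card_components_add E x y : ~~ linked E x y ->
  #|components E| = #|components ([set x; y] |: E)|.+1.
Proof.
move=> nxy; set E' := _ |: E.
have nxyC : component E x != component E y by rewrite eq_component.
pose U := component E x :|: component E y.
have compE' z : component E' z =
    if linked E z x || linked E z y then U else component E z.
  apply/setP => w; rewrite in_component linked_add.
  case: ifPn => [|/norP[/negbTE-> /negbTE->]]; last by rewrite in_component orbF.
  rewrite inE !in_component.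
  case/orP => [zx|zy].
    have zw : linked E z w = linked E x w.
      by have [_ ->] := linked_equiv E (in_setT z) (in_setT x) (in_setT w).
    have -> : linked E z y = false.
      apply/negbTE; apply: contra nxy => zy; rewrite linked_sym in zx.
      exact: linked_trans zx zy.
    by rewrite zw zx orbF.
  have zw : linked E z w = linked E y w.
    by have [_ ->] := linked_equiv E (in_setT z) (in_setT y) (in_setT w).
  have -> : linked E z x = false.
    apply/negbTE; apply: contra nxy => zx; rewrite linked_sym in zx.
    exact: linked_trans zx zy.
  by rewrite zw zy orbC.
have cx : component E x \in components E by apply: imset_f.
have cy : component E y \in components E by apply: imset_f.
have -> : components E' = U |: (components E :\ component E x :\ component E y).
  apply/setP => X; rewrite !inE; apply/imsetP/idP => [[z _ ->]|].
    rewrite compE'; case: ifPn => [|/norP[h1 h2]]; first by rewrite eqxx.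
    by rewrite !eq_component h1 h2 imset_f // orbT.
  case/orP => [/eqP->|/and3P[h1 h2 /imsetP[z _ eX]]].
    by exists x; rewrite ?inE // compE' linked_refl.
  exists z; rewrite ?inE // compE'; move: h1 h2.
  by rewrite eX !eq_component => /negbTE-> /negbTE->.
have nU : U \notin components E.
  apply/imsetP => -[z _ eU].
  have : x \in U by rewrite inE in_component linked_refl.
  have : y \in U by rewrite inE !in_component linked_refl orbT.
  rewrite eU !in_component => zy zx; rewrite linked_sym in zx.
  by move/negP: nxy; apply; apply: linked_trans zx zy.
rewrite cardsU1 !in_setD1 (negbTE nU) !andbF (cardsD1 (component E x)) cx.
by rewrite (cardsD1 (component E y)) !in_setD1 cy eq_sym nxyC.
Qed.

Lemma components0 : #|components set0| = #|V|.
Proof.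
rewrite /components card_imset ?cardsT // => x y /eqP; rewrite eq_component.
move=> /connectP[[|z p] //= /andP[]]; by rewrite /adj inE.
Qed.

Lemma graphic_subset E F : F \subset E -> graphic E -> graphic F.
Proof.
move=> /subsetP FE /forall_inP h; apply/forall_inP => e /FE; exact: h.
Qed.

(** The edgeless graph has [#|V|] components, and each added edge merges at most two of them. *)
Lemma leq_components_edges E : graphic E -> #|V| <= #|components E| + #|E|.
Proof.
elim: {E}#|E| {-2}E (erefl #|E|) => [|m IH] E.
  by move/eqP; rewrite cards_eq0 => /eqP->; rewrite components0 cards0 addn0.
move=> cE gE; have /card_gt0P[e he] : 0 < #|E| by rewrite cE.
have /cards2P[x [y [nxy ee]]] := forall_inP gE _ he.
have cE' : #|E :\ e| = m by move: cE; rewrite (cardsD1 e) he => -[].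
have := IH _ cE' (graphic_subset (subsetDl _ _) gE).
have dE : E = [set x; y] |: (E :\ e) by rewrite -ee setD1K.
rewrite cE cE'; have [h|h] := boolP (linked (E :\ e) x y).
  have -> : components E = components (E :\ e).
    by apply: eq_components; rewrite {1}dE; apply: linked_add_redundant.
  lia.
by rewrite (card_components_add h) -dE; lia.
Qed.

(** The equality case of [leq_components_edges]. This numerical form survives adding an edge between
    two components and yields edge counts at once; acyclicity is recovered in [forest_acyclic]. *)
Definition forest F : bool := #|components F| + #|F| == #|V|.

(** Take [T] of maximal size among forests between [F] and [E]: an edge of [E] joining two
    components of [T] could still be added. *)
Lemma forest_extension E F : graphic E -> F \subset E -> forest F ->
  exists T, [/\ F \subset T, T \subset E, forest T & linked T =2 linked E].
Proof.
move=> gE FE fF; pose P (T : {set {set V}}) := [&& F \subset T, T \subset E & forest T].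
have PF : P F by rewrite /P subxx FE.
case: (@arg_maxnP _ F P (fun T => #|T|) PF) => T /and3P[FT TE fT] maxT.
exists T; split=> // a b; apply/idP/idP.
  by apply: linked_subset => x y /(subsetP TE)/linked_edge.
apply: linked_subset => x y xyE; apply: contraT => nl.
have xyT : [set x; y] \notin T by apply: contra nl; apply: linked_edge.
have : P ([set x; y] |: T).
  rewrite /P subUset sub1set xyE TE (subset_trans FT) ?subsetUr //=.
  move: fT; rewrite /forest (card_components_add nl) cardsU1 xyT; by rewrite add1n addnS.
by move/maxT; rewrite /= cardsU1 xyT add1n ltnn.
Qed.

(** An edge of a cycle can be deleted without changing the components, which leaves too few edges
    for [leq_components_edges]. *)
Lemma forest_acyclic F : graphic F -> forest F -> acyclic_graph ([set: V], F).
Proof.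
move=> gF fF; apply/forallP => k; apply/forallP => -[p sp]; apply/implyP => k2.
apply/negP => /andP[/= cp up].
have {k2 sp} : 2 < size p by rewrite (eqP sp).
case: p cp up => [|x [|y [|z q]]] //= /and3P[xy yz cp] /and4P[].
rewrite !inE => /norP[nxy /norP[nxz nxq]] /norP[nyz nyq] _ _ _.
rewrite /adj /= in xy yz; pose F' := F :\ [set x; y].
have dF : F = [set x; y] |: F' by rewrite setD1K.
have h : linked F' x y.
  rewrite linked_sym; apply: (@linked_trans _ z).
    apply: linked_edge; rewrite !inE yz andbT; apply: contraNneq nxz.
    by move/set2_inj => [] [h1 h2]; rewrite ?h2 //; rewrite -h1 ?eqxx // in nxy.
  apply/connectP; exists (rcons q x); last by rewrite last_rcons.
  (* Follow the rest of the cycle from [z] to [x]. Each edge met starts at a vertex other than [x]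
     and [y], so it differs from the deleted edge. *)
  elim: q z nxz nyz cp nxq nyq {yz} => [|w q IH] z nxz nyz /=.
    rewrite /adj /= !inE => /andP[-> _] _ _; rewrite !andbT.
    by apply: contraNneq nyz => /set2_inj[][h1 h2]; rewrite -?h1 ?eqxx // ?h1 in nxz *.
  move=> /andP[zw cp]; rewrite !inE => /norP[nxw nxq] /norP[nyw nyq].
  rewrite IH // andbT /adj /= !inE in zw *; rewrite zw andbT.
  apply: contraNneq nxw => /set2_inj[][h1 h2]; last by rewrite h2.
  by rewrite h1 eqxx in nxz.
have := leq_components_edges (graphic_subset (subsetDl F [set [set x; y]]) gF).
have -> : components (F :\ [set x; y]) = components F.
  by apply: eq_components => a b; rewrite {2}dF linked_add_redundant.
by move: fF => /eqP<-; rewrite (cardsD1 [set x; y] F) xy add1n addnS ltnn.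
Qed.

End Components.

(** * Label sums of spanning trees *)

Section Discrepancy.
Variable V : finType.
Implicit Types (E F R T : {set {set V}}) (A C : {set V}) (x y z v : V).

(** A component has no crossing edges, and neither has its complement; one of the two has at most
    half of the vertices. *)
Lemma components_connected E : 0 < #|V| ->
  (forall A, A != set0 -> 2 * #|A| <= #|V| -> cut E A != set0) ->
  #|components E| = 1.
Proof.
move=> /card_gt0P[x _] cutE.
suff h y : linked E x y.
  have -> : components E = [set component E x].
    apply/setP => X; rewrite inE; apply/imsetP/eqP => [[y _ ->]|->]; last by exists x.
    by apply/eqP; rewrite eq_component linked_sym.
  by rewrite cards1.
apply: contraT => nxy.
have closed u w : [set u; w] \in E -> (u \in component E x) = (w \in component E x).
  move=> /linked_edge uw; rewrite !in_component; apply/idP/idP => h.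
    exact: linked_trans h uw.
  by rewrite linked_sym in uw; apply: linked_trans h uw.
have cut0 : cut E (component E x) = set0.
  apply/setP => -[u w]; rewrite [_ \in cut _ _]inE [_ \in set0]inE /=; apply/and3P => -[hu hw uw].
  by rewrite -(closed _ _ uw) hu in hw.
have cut0C : cut E (~: component E x) = set0.
  by apply/eqP; rewrite -cards_eq0 card_cutC cut0 cards0.
have [h|h] := leqP (2 * #|component E x|) #|V|.
  have nC : component E x != set0.
    by apply/set0Pn; exists x; rewrite in_component linked_refl.
  by have := cutE _ nC h; rewrite cut0 eqxx.
have nC : ~: component E x != set0.
  by apply/set0Pn; exists y; rewrite inE in_component.
suff hC : 2 * #|~: component E x| <= #|V|.
  by have := cutE _ nC hC; rewrite cut0C eqxx.
by have := cardsC (component E x); rewrite -/(component E x); lia.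
Qed.

(** First span the components of [R] by a forest [F], then extend [F] to a spanning tree of [E]; the
    edges of [F] alone give the bound on [T :&: R]. *)
Lemma spanning_tree_extension E R : graphic E -> R \subset E ->
  #|components E| = 1 ->
  exists2 T : {set {set V}}, T \subset E & (([set: V], T) \in spanning_trees ([set: V], E)) /\
    #|V| <= #|components R| + #|T :&: R| /\ #|T|.+1 = #|V|.
Proof.
move=> gE RE cE.
have f0 : @forest V set0 by rewrite /forest components0 cards0 addn0.
have [F [_ FR fF lF]] := forest_extension (graphic_subset RE gE) (sub0set R) f0.
have [T [FT TE fT lT]] := forest_extension gE (subset_trans FR RE) fF.
have gT := graphic_subset TE gE.
exists T => //; split; last first.
  split; last first.
    by move: fT; rewrite /forest (eq_components lT) cE add1n => /eqP.
  move: fF; rewrite /forest (eq_components lF) => /eqP<-.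
  by rewrite leq_add2l subset_leq_card // subsetI FT.
have sT : simple_graph ([set: V], T).
  by apply/forall_inP => e he; rewrite subsetT andbT; apply: (forall_inP gT).
rewrite inE /subgraph /tree sT /= TE subxx eqxx forest_acyclic // !andbT /=.
move: cE => /eqP/cards1P[C cC].
apply/andP; split.
  have : C \in components E by rewrite cC inE.
  by move=> /imsetP[x _ _]; apply/set0Pn; exists x; rewrite inE.
apply/forall_inP => x _; apply/forall_inP => y _.
have : linked T x y; last by [].
rewrite lT -eq_component.
have h z : component E z = C by apply/set1P; rewrite -cC imset_f.
by rewrite !h.
Qed.

Section Labeling.
Variables (E : {set {set V}}) (f : labeling ([set: V], E)).

(** The value [true] stands for the label -1 and [false] for the label 1. *)
Definition label_class (b : bool) : {set {set V}} :=
  [set val e | e : edge ([set: V], E) in [pred e | f e == b]].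

Lemma label_class_sub b : label_class b \subset E.
Proof. by apply/subsetP => e /imsetP[[e' he] _ ->]. Qed.

Lemma label_class_cover e : e \in E ->
  (e \in label_class true) (+) (e \in label_class false).
Proof.
move=> he; pose e' : edge ([set: V], E) := Sub e he.
have h b : (e \in label_class b) = (f e' == b).
  apply/imsetP/eqP => [[e2 /eqP <- ee]|h]; last by exists e'; rewrite ?inE ?h.
  by congr (f _); apply: val_inj.
by rewrite !h; case: (f e').
Qed.

Lemma label_sumE T : T \subset E ->
  (label_sum f ([set: V], T) =
     #|T :&: label_class false|%:Z - #|T :&: label_class true|%:Z)%R.
Proof.
move=> TE; rewrite /label_sum (bigID (fun e => f e == false)) /=.
have h b : \sum_(e : edge ([set: V], E) | (val e \in T) && (f e == b)) 1
   = #|T :&: label_class b|.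
  rewrite sum1_card -(card_in_imset (f := val)); last by move=> ? ? _ _; apply: val_inj.
  apply: eq_card => X; rewrite inE; apply/imsetP/andP.
    move=> [e]; rewrite unfold_in => /andP[h1 h2] ->; split=> //.
    by apply/imsetP; exists e; rewrite ?inE.
  by move=> [XT /imsetP[e]]; rewrite unfold_in => h2 eX; exists e => //; rewrite unfold_in /= -eX XT.
rewrite -!h -!natz !natr_sum -sumrN.
congr (_ + _)%R.
  by apply: eq_bigr => e /andP[_ /eqP->].
apply: eq_big => e; first by case: (f e).
by case: (f e) => // /andP[].
Qed.

Lemma label_sum_ge T : T \subset E ->
  #|T :&: label_class false| - #|T :&: label_class true| <= `|label_sum f ([set: V], T)| /\
  #|T :&: label_class true| - #|T :&: label_class false| <= `|label_sum f ([set: V], T)|.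
Proof. by move=> /label_sumE ->; split; lia. Qed.

(** With c components in the class, some spanning tree has at least [#|V|] - c edges in it, hence at
    most c - 1 in the other class, as it has [#|V|] - 1 edges in all. *)
Lemma max_label_sum_ge b : graphic E -> #|components E| = 1 ->
  #|V| <= 2 * #|components (label_class b)| +
          max_label_sum (spanning_trees ([set: V], E)) f.
Proof.
move=> gE cE.
have [T TE [Ttree [le1 cT]]] := spanning_tree_extension gE (label_class_sub b) cE.
have le2 : `|label_sum f ([set: V], T)| <= max_label_sum (spanning_trees ([set: V], E)) f.
  by rewrite /max_label_sum (bigD1 _ Ttree) leq_maxl.
have cT2 : #|T| = #|T :&: label_class b| + #|T :&: label_class (~~ b)|.
  rewrite -cardsUI [X in _ + #|pred_of_set X|](_ : _ = set0) ?cards0 ?addn0.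
    apply: eq_card => e; rewrite !inE; case eT: (e \in T) => //=.
    have := label_class_cover (subsetP TE _ eT).
    by case: b {le1}; case: (_ \in _); case: (_ \in _).
  apply/setP => e; rewrite !inE; case eT: (e \in T) => //=.
  have := label_class_cover (subsetP TE _ eT).
  by case: b {le1}; case: (_ \in _); case: (_ \in _).
have [] := label_sum_ge TE; move: le2 le1 cT2 cT.
move: (max_label_sum _ _) (absz _) => D S.
by case: b => /=; move: #|_ :&: _| #|_ :&: _| #|components _| #|T| #|V| => *; lia.
Qed.

End Labeling.

End Discrepancy.

(** * Two-colourings of the edges of a cubic graph *)

Section TwoColorings.
Variable V : finType.
Implicit Types (E F R B T : {set {set V}}) (A C : {set V}) (x y z v : V).

(** The threshold serves two ends: a set above it sends out at least [#|A|] + 2 edges, the surplus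
    used in [card_components_le]; a set below it leaves room for [#|A|] switchings in
    [card_cubic_cut_small]. *)
Definition small_boundary E L : {set {set V}} :=
  [set A : {set V} | 0 < #|A| <= L & #|cut E A| <= #|A|.+1].

Definition bipartition E R B :=
  [/\ R \subset E, B \subset E & forall e, e \in E -> (e \in R) (+) (e \in B)].

Lemma bipartition_sym E R B : bipartition E R B -> bipartition E B R.
Proof. by case=> h1 h2 h3; split=> // e /h3; rewrite addbC. Qed.

Lemma card_nbhd_bipartition E R B v : E \in cubic V -> bipartition E R B ->
  #|nbhd R v| + #|nbhd B v| = 3.
Proof.
move=> hE [RE BE RB]; rewrite -(card_nbhd v hE) -cardsUI.
rewrite [X in _ + #|pred_of_set X|](_ : _ = set0) ?cards0 ?addn0.
  apply: eq_card => y; rewrite !inE; apply/orP/idP => [[/(subsetP RE)|/(subsetP BE)]//|].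
  by move=> /RB; case: (_ \in R); case: (_ \in B) => //; [left|right].
apply/setP => y; rewrite !inE; apply/andP => -[h1 h2].
by have := RB _ (subsetP RE _ h1); rewrite h1 h2.
Qed.

Lemma leq_card_pairs A F (D : {set V * V}) :
  (forall p, p \in D -> (p.1 \in A) && ([set p.1; p.2] \in F)) ->
  #|D| <= \sum_(v in A) #|nbhd F v|.
Proof.
move=> hD; have -> : \sum_(v in A) #|nbhd F v| =
    #|[set p : V * V | (p.1 \in A) && ([set p.1; p.2] \in F)]|.
  rewrite -sum1dep_card.
  rewrite -(pair_big_dep (mem A) (fun x y => [set x; y] \in F) (fun _ _ => 1)) /=.
  by apply: eq_bigr => v _; rewrite -sum1_card; apply: eq_bigl => y; rewrite inE.
by apply: subset_leq_card; apply/subsetP => p /hD; rewrite inE.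
Qed.

Lemma card_cut_component E R B x : bipartition E R B ->
  #|cut E (component R x)| <= \sum_(v in component R x) #|nbhd B v|.
Proof.
move=> [RE BE RB]; apply: leq_card_pairs => -[a b]; rewrite [_ \in cut _ _]inE /=.
move=> /and3P[ha hb hab]; rewrite ha /=; have := RB _ hab.
have [/linked_edge h|//] := boolP ([set a; b] \in R).
rewrite in_component in ha; rewrite in_component in hb.
by rewrite (linked_trans ha h) in hb.
Qed.

(** Every component C of [R] is charged 2L. If it has more than L vertices, the term [2 * #|C|]
    pays; if it has small boundary, the second term pays. Otherwise at least [#|C|] + 2 edges of [B]
    leave it, so the truncated sum of deg_B - 1 over C is at least 2. *)
Lemma card_components_le E R B L : bipartition E R B ->
  2 * L * #|components R| <= 2 * #|V| + 2 * L * #|small_boundary E L|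
     + L * \sum_v (#|nbhd B v| - 1).
Proof.
move=> hRB.
have pR := components_partition R; have tR : trivIset (components R).
  by case/and3P: pR.
have cov : cover (components R) = [set: V] by case/and3P: pR => /eqP.
have cV : #|V| = \sum_(C in components R) #|C|.
  by rewrite -cardsT; apply: card_partition.
have sB : \sum_v (#|nbhd B v| - 1) =
    \sum_(C in components R) \sum_(v in C) (#|nbhd B v| - 1).
  by rewrite -big_trivIset //= cov; apply: eq_bigl => v; rewrite inE.
have sS : \sum_(C in components R) (C \in small_boundary E L) <= #|small_boundary E L|.
  rewrite -sum1_card big_mkcond [X in _ <= X]big_mkcond; apply: leq_sum => C _.
  by case: (C \in components R); case: (C \in small_boundary E L).
suff h : \sum_(C in components R) (2 * L) <= \sum_(C in components R)
    (2 * #|C| + 2 * L * (C \in small_boundary E L) + L * \sum_(v in C) (#|nbhd B v| - 1)).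
  rewrite sum_nat_const mulnC in h; apply: leq_trans h _.
  rewrite big_split big_split /= -!big_distrr /= -cV -sB leq_add2r leq_add2l.
  by rewrite leq_mul2l sS orbT.
apply: leq_sum => C hC; have [x _ eC] := imsetP hC.
have C0 : 0 < #|C|.
  by apply/card_gt0P; exists x; rewrite eC in_component linked_refl.
have [small|large] := leqP #|C| L; last by nia.
have [hs|hs] := boolP (C \in small_boundary E L); first by nia.
rewrite inE C0 small /= -ltnNge in hs.
have h1 := card_cut_component x hRB; rewrite -eC in h1.
have h2 : \sum_(v in C) #|nbhd B v| <= \sum_(v in C) (#|nbhd B v| - 1) + #|C|.
  rewrite -sum1_card -big_split /=; apply: leq_sum => v _.
  by rewrite addnC -leq_subLR.
have h3 : 2 <= \sum_(v in C) (#|nbhd B v| - 1).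
  by rewrite -(leq_add2r #|C|) add2n; apply: leq_trans h2; apply: leq_trans h1.
by rewrite [2 * L]mulnC -addnA; apply: leq_trans (leq_addl _ _); apply: leq_trans (leq_addl _ _); rewrite leq_mul2l h3 orbT.
Qed.

Definition mixed R B : {set V} := [set v | (0 < #|nbhd R v|) && (0 < #|nbhd B v|)].

(** In a two-coloured cubic graph these are the vertices all of whose three edges have the colour
    opposite to [B]. *)
Definition pure B : {set V} := [set v | #|nbhd B v| == 0].

(** An edge leaving [pure B] belongs to [R], and its outer end also meets [B]; so it is one of the
    three edges at a mixed vertex. *)
Lemma card_cut_pure E R B : E \in cubic V -> bipartition E R B ->
  #|cut E (pure B)| <= 3 * #|mixed R B|.
Proof.
move=> hE hRB; have [RE BE RB] := hRB.
rewrite -(card_incident_pairs _ hE).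
pose sw (p : V * V) := (p.2, p.1).
have sw_inj : injective sw by move=> [a b] [c d] [-> ->].
rewrite -(card_imset (mem (cut E (pure B))) sw_inj); apply: subset_leq_card; apply/subsetP => z /imsetP[[a b] hz ->{z}].
move: hz; rewrite [_ \in cut _ _]inE /= => /and3P[ha hb hab]; rewrite !inE /=.
rewrite setUC hab andbT; move: ha hb; rewrite !inE -lt0n => /eqP ha ->.
rewrite andbT; apply/card_gt0P; exists a; rewrite inE setUC.
have := RB _ hab; case: (_ \in R) => //= hB.
have : b \in nbhd B a by rewrite inE.
by rewrite (cards0_eq ha) inE.
Qed.

(** The colour degrees at a vertex are 3 and 0 or 2 and 1: the truncated terms give 2 at a
    monochromatic vertex and 1 at a mixed one, which the last summand completes to 2. *)
Lemma sum_nbhd_pred E R B : E \in cubic V -> bipartition E R B ->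
  \sum_v (#|nbhd R v| - 1) + \sum_v (#|nbhd B v| - 1) + #|mixed R B| = 2 * #|V|.
Proof.
move=> hE hRB; rewrite -[#|mixed R B|]sum1_card [X in _ + X]big_mkcond /=.
rewrite -!big_split /= -[#|V|]sum1_card big_distrr /=; apply: eq_bigr => v _.
have := card_nbhd_bipartition v hE hRB; rewrite inE.
move: #|nbhd R v| #|nbhd B v| => r b; move: r => [|[|[|[|r]]]] //; move: b => [|[|[|[|b]]]] //=; lia.
Qed.

Lemma sum_nbhd_pred_le E R B : E \in cubic V -> bipartition E R B ->
  \sum_v (#|nbhd R v| - 1) <= 2 * #|pure B| + #|mixed R B|.
Proof.
move=> hE hRB.
rewrite -[#|pure B|]sum1_card -[#|mixed R B|]sum1_card.
rewrite [\sum_(i in pure B) 1]big_mkcond [\sum_(i in mixed _ _) 1]big_mkcond /=.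
rewrite big_distrr -big_split /=; apply: leq_sum => v _; rewrite !inE.
have := card_nbhd_bipartition v hE hRB.
move: #|nbhd R v| #|nbhd B v| => r b; move: r => [|[|[|[|r]]]] //; move: b => [|[|[|[|b]]]] //=; lia.
Qed.

Lemma discrepancy_ge E L M : E \in cubic V -> 0 < #|V| -> 0 < M -> L = 100 * M ->
  (forall A, A != set0 -> 2 * #|A| <= #|V| -> cut E A != set0) ->
  L * #|small_boundary E L| <= #|V| ->
  (forall A, #|V| <= 4 * #|A| -> 2 * #|A| <= #|V| -> #|V| < M * #|cut E A|) ->
  #|V| <= L * discrepancy ([set: V], E) (spanning_trees ([set: V], E)).
Proof.
move=> hE V0 M0 LM hcon hsmall hexp.
have gE : graphic E by move: hE; rewrite inE => /andP[].
have cE := components_connected V0 hcon.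
rewrite /discrepancy; set f := (X in max_label_sum _ X); move: f => f.
have hRB : bipartition E (label_class f false) (label_class f true).
  by split; rewrite ?label_class_sub // => e /(label_class_cover f); rewrite addbC.
move: hRB (max_label_sum_ge f false gE cE) (max_label_sum_ge f true gE cE).
move: (label_class f false) (label_class f true) (max_label_sum _ f) => R B D hRB hR hB.
rewrite leqNgt; apply/negP => hD.
have hBR := bipartition_sym hRB.
have k1 := card_components_le L hRB; have k2 := card_components_le L hBR.
have s1 := sum_nbhd_pred hE hRB.
have s2 := sum_nbhd_pred_le hE hRB; have s3 := sum_nbhd_pred_le hE hBR.
have c1 := card_cut_pure hE hRB; have c2 := card_cut_pure hE hBR.
have mixC : mixed B R = mixed R B by apply/setP => v; rewrite !inE andbC.
rewrite mixC in s3 c2.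
have e1 := hexp (pure B); have e2 := hexp (pure R).
have disj : #|pure B| + #|pure R| <= #|V|.
  rewrite -cardsUI [X in _ + #|pred_of_set X|](_ : _ = set0) ?cards0 ?addn0 ?max_card //.
  apply/setP => v; rewrite !inE; apply/andP => -[/eqP h1 /eqP h2].
  by have := card_nbhd_bipartition v hE hRB; rewrite h1 h2.
move: k1 k2 s1 s2 s3 c1 c2 e1 e2 disj hR hB hsmall.
clear - M0 LM hD V0.
move: #|cut E (pure B)| #|cut E (pure R)| #|pure B| #|pure R| #|mixed R B|.
move: #|small_boundary E L| #|components R| #|components B| (\sum_v _) (\sum_v _) hD V0.
move: #|V| => n m cR cB sB sR hD V0 cutB cutR pB pR mix.
move=> k1 k2 s1 s2 s3 c1 c2 e1 e2 disj hR hB hsmall.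
have hR' := leq_mul (leqnn L) hR; have hB' := leq_mul (leqnn L) hB.
have s1' := congr1 (muln L) s1; have s2' := leq_mul (leqnn L) s2; have s3' := leq_mul (leqnn L) s3.
rewrite !mulnDr in hR' hB' s1' s2' s3'.
(* Write n for the number of vertices. Each colour gives L n < 5n + L s, where s is the truncated
   degree sum of the other colour. Adding both and using [s1] bounds the mixed vertices. *)
have m1 : L * mix < 10 * n by clear c1 c2 e1 e2 LM; lia.
have p1 : 15 * n + 2 * L * pR > L * n by clear c1 c2 e1 e2 LM; lia.
have p2 : 15 * n + 2 * L * pB > L * n by clear c1 c2 e1 e2 LM; lia.
have q1 : n <= 4 * pR by clear - LM M0 p1; nia.
have q2 : n <= 4 * pB by clear - LM M0 p2; nia.
(* Since L is at least 100, both pure sets have at least n/4 vertices. They are disjoint, so one has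
   at most n/2 and expands: n < M |cut| <= 3 M |mixed|, whereas 100 M |mixed| < 10 n. *)
case: (leqP (2 * pB) n) => h.
  have {}e1 := e1 q2 h; have := leq_mul (leqnn M) c1; clear - LM m1 e1; lia.
have {}e2 := e2 q1; have := leq_mul (leqnn M) c2; clear - LM m1 e2 disj h; lia.
Qed.
End TwoColorings.

(** * First moment bounds *)

Section SmallSets.
Variable V : finType.
Implicit Types (A : {set V}).
Local Notation n := #|V|.

(** Each of [s] switchings gains a factor of at most 12 L^2 / n. The condition on [b] and [s] keeps
    [3 * #|A| - b] positive at every step. *)
Lemma card_cubic_cut_small L A b s : 0 < #|A| <= L -> 30 * L <= n ->
  b + 2 * s <= 3 * #|A| + 1 ->
  #|cubic_cut A b| * n ^ s <= (12 * L ^ 2) ^ s * #|cubic V|.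
Proof.
move=> /andP[A0 AL] Ln; elim: s b => [|s IH] b bs.
  rewrite !expn0 mul1n muln1 subset_leq_card //.
  by apply/subsetP => E; rewrite inE => /andP[].
have {}IH := IH b.+2; have h := switching A b.
have h1 : #|cubic_cut A b| * n <= #|cubic_cut A b.+2| * (12 * L ^ 2).
  (* The factor of [A] is only used as at least 1. The other one needs 2n >= 3 [#|A|] + 19b, which
     follows from n >= 30L and b < 3 [#|A|]. *)
  have c1 : n + 18 * b <= (3 * #|A| - b) * (3 * #|~: A| - b).
    have := cardsC A; move: A0 AL bs Ln; clear.
    move: #|A| #|~: A| n => k m n A0 AL bs Ln nkm.
    apply: (@leq_trans (3 * m - b)); first by lia.
    by rewrite leq_pmull //; lia.
  have c2 : b.+2 * b.+1 <= 12 * L ^ 2.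
    apply: (@leq_trans ((3 * L + 1) * (3 * L))); first by apply: leq_mul; clear -bs AL; lia.
    by move: (leq_trans A0 AL); clear; nia.
  rewrite -(leq_add2r (#|cubic_cut A b| * (18 * b))) -mulnDr.
  apply: leq_trans (leq_mul (leqnn _) c1) _; apply: leq_trans h _.
  by rewrite addnC leq_add2r leq_mul2l c2 orbT.
move: (12 * L ^ 2) h1 IH => X h1 IH; rewrite !expnS mulnA; apply: leq_trans (leq_mul h1 (leqnn _)) _.
rewrite [X in X <= _]mulnAC [X in X <= _]mulnC -[X in _ <= X]mulnA  leq_mul2l IH ?orbT //.
by clear -bs; lia.
Qed.

(** The mean number of such sets is bounded independently of n. For [#|A|] = k and at most k + 1
    crossing edges, k switchings fit, as (k + 1) + 2k = 3k + 1; the resulting factor n^-k cancels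
    the number of k-sets, which is at most n^k. *)
Lemma sum_card_small_boundary L : 30 * L <= n -> 0 < n ->
  \sum_(E in cubic V) #|small_boundary E L| <=
    L.+1 * (L.+2 * (12 * L ^ 2) ^ L) * #|cubic V|.
Proof.
move=> Ln n0.
have -> : \sum_(E in cubic V) #|small_boundary E L| =
   \sum_(A : {set V} | 0 < #|A| <= L) #|[set E in cubic V | #|cut E A| <= #|A|.+1]|.
  transitivity (\sum_(E in cubic V) \sum_(A : {set V} | 0 < #|A| <= L) (#|cut E A| <= #|A|.+1 : nat)).
    apply: eq_bigr => E _; rewrite -sum1dep_card -big_mkcondr.
    by apply: eq_bigl => A; rewrite andbC.
  rewrite exchange_big /=; apply: eq_bigr => A _.
  by rewrite -sum1dep_card big_mkcondr.
rewrite (partition_big (fun A : {set V} => inord #|A| : 'I_L.+1) predT) //=.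
rewrite -mulnA -[X in _ <= X * _]card_ord -sum_nat_const; apply: leq_sum => k _.
have [k0|k0] := posnP k.
  rewrite big_pred0 // => A; apply/andP => -[/andP[A0 AL] /eqP /(congr1 val)].
  by rewrite /= inordK ?ltnS // k0 => h; rewrite h in A0.
have bound (A : {set V}) : #|A| = k ->
  #|[set E in cubic V | #|cut E A| <= #|A|.+1]| * n ^ k <= L.+2 * (12 * L ^ 2) ^ L * #|cubic V|.
  move=> Ak; have kL : k <= L by rewrite -ltnS ltn_ord.
  have AL : 0 < #|A| <= L by rewrite Ak k0.
  apply: (@leq_trans (\sum_(b < k.+2) #|cubic_cut A b| * n ^ k)).
    rewrite -big_distrl leq_mul2r; apply/orP; right; rewrite -sum1_card.
    rewrite (partition_big (fun E => inord #|cut E A| : 'I_k.+2) predT) //=.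
    apply: leq_sum => b _; rewrite sum1_card subset_leq_card //; apply/subsetP => E.
    rewrite unfold_in inE Ak => /andP[/andP[hE h] /eqP eb]; rewrite inE hE /= -eb inordK //.
  rewrite -mulnA; apply: (@leq_trans (\sum_(b < k.+2) (12 * L ^ 2) ^ L * #|cubic V|)); last first.
    by rewrite sum_nat_const card_ord leq_mul2r !ltnS kL orbT.
  apply: leq_sum => b _; apply: leq_trans (card_cubic_cut_small AL Ln _) _.
    by have := ltn_ord b; clear -Ak; lia.
  rewrite leq_mul2r; apply/orP; right; rewrite leq_pexp2l // muln_gt0 /= expn_gt0.
  by rewrite (leq_trans k0 kL).
have nk0 : 0 < n ^ k by rewrite expn_gt0 n0.
rewrite -(leq_pmul2r nk0) big_distrl /=.
apply: (@leq_trans (\sum_(A : {set V} | #|A| == k) L.+2 * (12 * L ^ 2) ^ L * #|cubic V|)).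
  rewrite [X in X <= _]big_mkcond [X in _ <= X]big_mkcond; apply: leq_sum => A _.
  case: ifP => // /andP[/andP[A0 AL] /eqP/(congr1 val)].
  by rewrite /= inordK ?ltnS // => Ak; have := bound A Ak; rewrite Ak eqxx.
rewrite sum_nat_const mulnC leq_mul2l; apply/orP; right.
have -> : #|[pred A : {set V} | #|A| == k]| = 'C(n, k).
  by rewrite -card_draws; apply: eq_card => A; rewrite inE.
have h := bin_ffact n k; apply: (@leq_trans (n ^_ k)).
  by rewrite -h leq_pmulr // fact_gt0.
rewrite ffact_prod -[X in _ <= _ ^ X]card_ord -prod_nat_const leq_prod // => i _.
exact: leq_subr.
Qed.

(** Markov's inequality. *)
Lemma card_many_small_le L : 30 * L <= n -> 0 < n ->
  #|[set E in cubic V | n < L * #|small_boundary E L|]| * n <=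
    L * (L.+1 * (L.+2 * (12 * L ^ 2) ^ L)) * #|cubic V|.
Proof.
move=> Ln n0; rewrite -mulnA.
apply: leq_trans (leq_mul (leqnn L) (sum_card_small_boundary Ln n0)).
rewrite big_distrr -sum_nat_const /= big_mkcond [X in _ <= X]big_mkcond.
apply: leq_sum => E _; rewrite inE; case: (E \in cubic V) => //=.
by case: ifP => // /ltnW.
Qed.

End SmallSets.

Local Open Scope ring_scope.

(** * Products of switching ratios *)

Section Ratios.
Variables (R : realFieldType) (n k : nat).
Implicit Types i j s : nat.

(** The factor from [switching] for b = 2j, with k = [#|A|]. The error 18b is absorbed by the 36 in
    the last factor, since 36 (3k - 2j) >= 36j = 18b for j <= k. *)
Definition switch_ratio j : R :=
  ((2 * j%:R + 1) * (2 * j%:R + 2)) /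
  ((3 * k%:R - 2 * j%:R) * (3 * (n%:R - k%:R) - 2 * j%:R - 36)).

Hypotheses (k0 : (0 < k)%N) (kn : (2 * k <= n)%N).

Let kR : 1 <= k%:R :> R. Proof. by rewrite ler1n. Qed.
Let knR : 2 * k%:R <= n%:R :> R. Proof. by rewrite -natrM ler_nat. Qed.

Lemma switch_den_gt0 j : (72 < n)%N -> (j <= k)%N ->
  0 < 3 * k%:R - 2 * j%:R :> R /\ 0 < 3 * (n%:R - k%:R) - 2 * j%:R - 36 :> R.
Proof.
move=> n72 jk.
have jkR : j%:R <= k%:R :> R by rewrite ler_nat.
have n72R : 72 < n%:R :> R by rewrite ltr_nat.
by have := kR; have := knR; split; lra.
Qed.

Lemma switch_ratio_gt0 j : (72 < n)%N -> (j <= k)%N -> 0 < switch_ratio j.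
Proof.
move=> n72 jk; have [h1 h2] := switch_den_gt0 n72 jk.
have j0 : 0 <= j%:R :> R by [].
by rewrite divr_gt0 ?mulr_gt0 //; lra.
Qed.

(** Passing from [s] to [s + 1] multiplies the binomial by (n - s) / (s + 1). The s + 1 cancels
    against the numerator 2s + 2 of the ratio, leaving the factor on the right times a quotient of
    two terms linear in n. *)
Lemma bin_prod_switch_ratio s : (1000 <= n)%N -> (s <= k)%N ->
  'C(n, s)%:R * \prod_(j < s) switch_ratio j <=
  (11 / 10) ^+ s * \prod_(j < s) (2 * (2 * j%:R + 1) / (3 * k%:R - 2 * j%:R)).
Proof.
move=> n1000; elim: s => [|s IH] sk; first by rewrite !big_ord0 bin0 expr0.
have {}IH := IH (ltnW sk).
have n72 : (72 < n)%N by lia.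
have [d1 d2] := switch_den_gt0 n72 (ltnW sk).
have s0 : 0 <= s%:R :> R by [].
have skR : s%:R + 1 <= k%:R :> R by rewrite natr1 ler_nat.
have n1000R : 1000 <= n%:R :> R by rewrite ler_nat.
have h1 := kR; have h2 := knR.
have binS : 'C(n, s.+1)%:R = 'C(n, s)%:R * ((n%:R - s%:R) / (s%:R + 1)) :> R.
  have sn : (s <= n)%N by apply: leq_trans (ltnW sk) (leq_trans _ kn); rewrite leq_pmull.
  have /(congr1 (fun m => m%:R : R)) := mul_bin_left n s.
  rewrite !natrM natrB // -natr1 => h.
  by rewrite mulrA [X in _ = X / _]mulrC -h mulrAC mulfV ?mul1r //; lra.
rewrite binS !big_ord_recr /= exprSr.
have -> : 'C(n, s)%:R * ((n%:R - s%:R) / (s%:R + 1)) * (\prod_(i < s) switch_ratio i * switch_ratio s)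
  = ('C(n, s)%:R * \prod_(i < s) switch_ratio i) *
    ((n%:R - s%:R) / (s%:R + 1) * switch_ratio s) by rewrite mulrACA.
rewrite [X in _ <= X]mulrACA; have r0 := switch_ratio_gt0 n72 (ltnW sk); apply: ler_pM => //.
- rewrite mulr_ge0 // prodr_ge0 // => i _; apply: ltW; apply: switch_ratio_gt0 => //.
  exact: ltnW (ltn_trans (ltn_ord i) sk).
- by rewrite mulr_ge0 ?(ltW r0) // divr_ge0 //; lra.
have -> : (n%:R - s%:R) / (s%:R + 1) * switch_ratio s =
  (2 * (2 * s%:R + 1) / (3 * k%:R - 2 * s%:R)) *
  ((n%:R - s%:R) / (3 * (n%:R - k%:R) - 2 * s%:R - 36)).
  by rewrite /switch_ratio; field; rewrite !lt0r_neq0 //; lra.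
rewrite [X in _ <= X]mulrC; apply: ler_wpM2l.
  by rewrite divr_ge0 ?(ltW d1) //; lra.
(* The quotient is at most 11/10: for s < k <= n/2 this reduces to n/20 exceeding a constant below
   40, which n >= 1000 ensures. *)
by rewrite ler_pdivrMr //; lra.
Qed.

End Ratios.

Section DoubleFactorial.
Variable (R : realFieldType).

(* Two steps in [k] multiply the product by
   [4 (2k+1) (2k+3) / (3 (3k+2) (3k+4)) <= 16/27 < (7/9)^2]. *)
Lemma prod_odd_ratio_le k :
  \prod_(j < k) (2 * (2 * j%:R + 1) / (3 * k%:R - 2 * j%:R)) <= (7 / 9) ^+ k :> R.
Proof.
(* Reversing the index gives denominators m + 2 + 2j, so that the products for m and m + 2 share
   most of their factors. *)
have rev m : \prod_(j < m) (3 * m%:R - 2 * j%:R : R) = \prod_(j < m) (m%:R + 2 + 2 * j%:R).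
  rewrite (reindex_inj rev_ord_inj) /=; apply: eq_bigr => j _.
  have /(congr1 (fun i => i%:R : R)) : (m - j.+1 + j.+1 = m)%N by rewrite subnK.
  by rewrite natrD -natr1; lra.
have eqP m : \prod_(j < m) (2 * (2 * j%:R + 1) / (3 * m%:R - 2 * j%:R)) =
   (\prod_(j < m) (2 * (2 * j%:R + 1))) / \prod_(j < m) (m%:R + 2 + 2 * j%:R) :> R.
  by rewrite -rev big_split prodfV.
suff h : forall m, \prod_(j < m) (2 * (2 * j%:R + 1) / (3 * m%:R - 2 * j%:R)) <= (7 / 9) ^+ m :> R
  /\ \prod_(j < m.+1) (2 * (2 * j%:R + 1) / (3 * m.+1%:R - 2 * j%:R)) <= (7 / 9) ^+ m.+1 :> R.
  by have [] := h k.
elim=> [|m [IH1 IH2]].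
  split; first by rewrite big_ord0 expr0.
  by rewrite big_ord1 expr1 mulr0 add0r subr0 !mulr1; lra.
split=> //; move: IH1; rewrite !eqP => IH1.
have m0 : 0 <= m%:R :> R by [].
have D0 i : 0 < \prod_(j < i) (m%:R + 2 + 2 * j%:R : R).
  by apply: prodr_gt0 => j _; have : 0 <= j%:R :> R by []; lra.
(* The factor m + 2 completes the product for m + 2 at its lower end; it becomes the product for m
   with three further factors. *)
have D2 : \prod_(j < m.+2) (m.+2%:R + 2 + 2 * j%:R : R) * (m%:R + 2) =
   \prod_(j < m) (m%:R + 2 + 2 * j%:R) * (3 * m%:R + 2) * (3 * m%:R + 4) * (3 * m%:R + 6).
  transitivity (\prod_(j < m.+3) (m%:R + 2 + 2 * j%:R : R)).
    rewrite [RHS]big_ord_recl mulrC /= mulr0 addr0; congr (_ * _).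
    by apply: eq_bigr => j _; rewrite /bump /= -!natr1; ring.
  by rewrite !big_ord_recr /= -!natr1; congr (_ * _ * _ * _); ring.
have -> : \prod_(j < m.+2) (m.+2%:R + 2 + 2 * j%:R : R) =
   \prod_(j < m) (m%:R + 2 + 2 * j%:R) * (3 * (3 * m%:R + 2) * (3 * m%:R + 4)).
  apply: (@mulIf _ (m%:R + 2)); first by rewrite lt0r_neq0 //; lra.
  by rewrite D2; ring.
rewrite !big_ord_recr /=.
set N := \prod_(j < m) _; set D := \prod_(j < m) _.
have -> : N * (2 * (2 * m%:R + 1)) * (2 * (2 * m.+1%:R + 1)) /
    (D * (3 * (3 * m%:R + 2) * (3 * m%:R + 4))) =
   (N / D) * (4 * (2 * m%:R + 1) * (2 * m%:R + 3) / (3 * (3 * m%:R + 2) * (3 * m%:R + 4))).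
  by rewrite -natr1; field; rewrite (lt0r_neq0 (D0 m)) !lt0r_neq0 //; lra.
rewrite -[m.+2]addn2 exprD.
have N0 : 0 <= N.
  by apply: prodr_ge0 => j _; have : 0 <= j%:R :> R by []; lra.
apply: ler_pM => //.
- by rewrite divr_ge0 // ltW // D0.
- by rewrite divr_ge0 // !mulr_ge0 //; lra.
rewrite ler_pdivrMr; last by rewrite !mulr_gt0 //; lra.
by nra.
Qed.

End DoubleFactorial.

(** Union bound over all k-sets: the gain from k switchings beats the binomial geometrically,
    because 11/10 * 7/9 < 9/10. *)
Lemma bin_prod_switch_ratio_le (R : realFieldType) n k :
  (0 < k)%N -> (2 * k <= n)%N -> (1000 <= n)%N ->
  'C(n, k)%:R * \prod_(j < k) switch_ratio R n k j <= (9 / 10) ^+ k.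
Proof.
move=> k0 kn n1000; apply: le_trans (bin_prod_switch_ratio R k0 kn n1000 (leqnn k)) _.
apply: (@le_trans _ _ ((11 / 10) ^+ k * (7 / 9) ^+ k)).
  by rewrite ler_wpM2l ?prod_odd_ratio_le // exprn_ge0 //; lra.
by rewrite -exprMn lerXn2r ?nnegrE //; lra.
Qed.

Section CutCounts.
Variables (R : realFieldType) (V : finType).
Implicit Types (A : {set V}).

Local Notation rho A j := (switch_ratio R #|V| #|A| j).

(** The ratio provided by [switching] grows with [b], so it suffices to evaluate it at 2j; this
    treats both parities of [b] together. *)
Lemma card_cubic_cut_ratio A b j : (72 < #|V|)%N -> (0 < #|A|)%N ->
  (2 * #|A| <= #|V|)%N -> (b <= 2 * j)%N -> (j <= #|A|)%N ->
  #|cubic_cut A b|%:R <= rho A j * #|cubic_cut A b.+2|%:R.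
Proof.
move=> n72 k0 kn bj jk.
have := switching A b.
have := cardsC A; set k := #|A| in k0 kn jk *; set m := #|~: A| => nkm.
set c := #|cubic_cut A b|; set c' := #|cubic_cut A b.+2|.
have [d1 d2] := switch_den_gt0 R k0 kn n72 jk.
have bk3 : (b <= 3 * k)%N by clear -bj jk; lia.
have bm3 : (b <= 3 * m)%N by clear -bj jk nkm kn; lia.
rewrite -(ler_nat R) !natrD !natrM !natrB // !natrM -!natr1 => h.
have nR : #|V|%:R - k%:R = m%:R :> R by rewrite -nkm natrD addrAC subrr add0r.
rewrite nR in d2; rewrite /switch_ratio nR mulrAC ler_pdivlMr ?mulr_gt0 //.
have c0 : 0 <= c%:R :> R by [].
have c0' : 0 <= c'%:R :> R by [].
have b0 : 0 <= b%:R :> R by [].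
have bjR : b%:R <= 2 * j%:R :> R by rewrite -natrM ler_nat.
have jkR : j%:R <= k%:R :> R by rewrite ler_nat.
apply: (@le_trans _ _ (c%:R * ((3 * k%:R - b%:R) * (3 * m%:R - b%:R) - 18 * b%:R))).
  rewrite ler_wpM2l //.
  move: d1 d2 bjR jkR b0; clear.
  move: (k%:R : R) (m%:R : R) (b%:R : R) (j%:R : R) => {}k {}m {}b {}j d1 d2 bj jk b0.
  nra.
apply: (@le_trans _ _ (c'%:R * ((b%:R + 1 + 1) * (b%:R + 1)))); first by lra.
rewrite mulrC ler_wpM2r //; move: bjR b0; clear.
by move: (b%:R : R) (j%:R : R) => {}b {}j *; nra.
Qed.

Lemma card_cubic_cut_chain A b i s : (72 < #|V|)%N -> (0 < #|A|)%N ->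
  (2 * #|A| <= #|V|)%N -> (b <= 2 * i)%N -> (i + s <= #|A|.+1)%N ->
  #|cubic_cut A b|%:R <= \prod_(t < s) rho A (i + t) * #|cubic V|%:R.
Proof.
move=> n72 k0 kn; elim: s b i => [|s IH] b i bi isk.
  rewrite big_ord0 mul1r ler_nat subset_leq_card //.
  by apply/subsetP => E; rewrite inE => /andP[].
have ik : (i <= #|A|)%N by rewrite -ltnS; apply: leq_trans isk; rewrite addnS ltnS leq_addr.
apply: le_trans (card_cubic_cut_ratio n72 k0 kn bi ik) _.
rewrite big_ord_recl addn0 -mulrA ler_wpM2l //.
  by rewrite ltW // switch_ratio_gt0.
rewrite addnS ltnS in isk; have := IH b.+2 i.+1; rewrite mulnS add2n !ltnS => /(_ bi isk) h.
apply: le_trans h _; rewrite le_eqVlt; apply/orP; left; apply/eqP; congr (_ * _).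
by apply: eq_bigr => t _; rewrite lift0 addSnnS.
Qed.

Lemma sum_over_subsets (g : nat -> R) :
  \sum_(A : {set V}) g #|A| = \sum_(k < #|V|.+1) 'C(#|V|, k)%:R * g k.
Proof.
rewrite (partition_big (fun A : {set V} => inord #|A| : 'I_#|V|.+1) predT) //=.
apply: eq_bigr => k _.
have h (A : {set V}) : (inord #|A| == k) = (#|A| == k).
  by rewrite -val_eqE /= inordK // ltnS max_card.
rewrite (eq_bigl _ _ h) (eq_bigr (fun=> g k)) => [|A /eqP->//].
rewrite sumr_const mulr_natl; congr (_ *+ _).
by rewrite -card_draws; apply: eq_card => A; rewrite inE.
Qed.

Lemma card_union_bound (T : finType) (X : {set T}) (Q : pred {set V}) (P : T -> pred {set V}) :
  (#|[set E in X | [exists A, Q A && P E A]]| <= \sum_(A | Q A) #|[set E in X | P E A]|)%N.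
Proof.
apply: (@leq_trans (\sum_(E in X) \sum_(A | Q A) P E A)).
  rewrite -sum1_card (eq_bigl (fun E => (E \in X) && [exists A, Q A && P E A])); last by move=> E; rewrite inE.
  rewrite big_mkcondr; apply: leq_sum => E _; case: ifP => // /existsP[A /andP[qA pA]].
  by rewrite (bigD1 A) //= pA.
rewrite exchange_big /=; apply: leq_sum => A _.
rewrite -sum1_card [X in (_ <= X)%N](eq_bigl (fun E => (E \in X) && P E A)); last by move=> E; rewrite inE.
by rewrite big_mkcondr leq_sum // => E _; case: (P E A).
Qed.

End CutCounts.

Lemma sum_mul_geometric_le (R : realFieldType) m :
  \sum_(k < m) k%:R * (9 / 10) ^+ k <= 90 :> R.
Proof.
(* Exact partial sums; the limit 90 is x / (1 - x)^2 at x = 9/10. *)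
suff -> : \sum_(k < m) k%:R * (9 / 10) ^+ k = 90 - (9 / 10) ^+ m * (10 * m%:R + 90) :> R.
  have m0 : 0 <= m%:R :> R by [].
  by rewrite gerBl mulr_ge0 ?exprn_ge0 //; lra.
elim: m => [|m IH]; first by rewrite big_ord0 expr0; lra.
by rewrite big_ord_recr /= IH exprSr -natr1; lra.
Qed.

(** Every factor of (2m)(2m - 1)...(m + 1) is at least m, and this product is the central binomial
    coefficient times m!. *)
Lemma expn_self_le m : (m ^ m <= 4 ^ m * m`!)%N.
Proof.
have h : (m ^ m <= (2 * m) ^_ m)%N.
  rewrite ffact_prod -[X in (_ ^ X)%N]card_ord -prod_nat_const leq_prod // => i _.
  by rewrite mul2n -addnn -addnBA ?leq_addr // ltnW.
apply: leq_trans h _; rewrite -bin_ffact leq_mul2r; apply/orP; right.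
have -> : (4 ^ m = (1 + 1) ^ (2 * m))%N by rewrite expnM.
rewrite expnDn.
have hm : (m < (2 * m).+1)%N by rewrite ltnS leq_pmull.
by rewrite (bigD1 (Ordinal hm)) //= !exp1n !muln1 leq_addr.
Qed.

(** * Disconnected graphs and weak expanders are rare *)

Section Events.
Variables (R : realFieldType) (V : finType).
Hypothesis n1000 : (1000 <= #|V|)%N.
Implicit Types (A : {set V}).
Local Notation n := #|V|.

Let n72 : (72 < n)%N. Proof. exact: leq_trans n1000. Qed.

Let nR : 1000 <= n%:R :> R. Proof. by rewrite ler_nat. Qed.

Lemma switch_ratio_last k : (0 < k)%N -> (2 * k <= n)%N ->
  switch_ratio R n k k <= 36 / n%:R * k%:R.
Proof.
move=> k0 kn; have [d1 d2] := switch_den_gt0 R k0 kn n72 (leqnn k).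
have kR : 1 <= k%:R :> R by rewrite ler1n.
have knR : 2 * k%:R <= n%:R :> R by rewrite -natrM ler_nat.
have nR' := nR; rewrite /switch_ratio ler_pdivrMr ?mulr_gt0 //.
apply: (@le_trans _ _ (12 * k%:R * k%:R)).
  by clear -kR; move: (k%:R : R) kR => x *; nra.
rewrite (_ : 36 / _ * _ * _ = 36 * k%:R * k%:R * ((3 * (n%:R - k%:R) - 2 * k%:R - 36) / n%:R)); last first.
  by field; rewrite lt0r_neq0 //; lra.
have h : 1 / 3 <= (3 * (n%:R - k%:R) - 2 * k%:R - 36) / n%:R :> R.
  by rewrite ler_pdivlMr; lra.
have kk : 0 <= k%:R * k%:R :> R by rewrite mulr_ge0.
apply: (@le_trans _ _ (36 * k%:R * k%:R * (1 / 3))); first by lra.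
by rewrite ler_wpM2l // -mulrA mulr_ge0.
Qed.

(* Iterating the switching up to [2k + 2] rather than [2k] crossing edges gives the
   additional factor [36 k / n], which makes the sum over [k] vanish. *)
Lemma card_disconnected_le :
  #|[set E in cubic V | [exists A : {set V},
      ((0 < #|A|) && (2 * #|A| <= n))%N && (cut E A == set0)]]|%:R
    <= 3240 / n%:R * #|cubic V|%:R :> R.
Proof.
have N0 : 0 <= #|cubic V|%:R :> R by [].
have nR0 : 0 < n%:R :> R by have := nR; lra.
pose g k : R := if ((0 < k) && (2 * k <= n))%N then
   \prod_(t < k.+1) switch_ratio R n k t * #|cubic V|%:R else 0.
apply: (@le_trans _ _ (\sum_(A : {set V}) g #|A|)).
  rewrite (le_trans (y := (\sum_(A : {set V} | ((0 < #|A|) && (2 * #|A| <= n))%N)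
     #|[set E in cubic V | cut E A == set0]|)%:R)) ?ler_nat ?card_union_bound //.
  rewrite natr_sum big_mkcond; apply: ler_sum => A _; rewrite /g.
  case: ifP => // /andP[A0 An].
  have -> : [set E in cubic V | cut E A == set0] = cubic_cut A 0.
    by apply/setP => E; rewrite !inE cards_eq0.
  exact: (@card_cubic_cut_chain R V A 0 0 #|A|.+1 n72 A0 An isT (leqnn _)).
rewrite sum_over_subsets.
apply: (@le_trans _ _ (\sum_(k < n.+1) (k%:R * (9 / 10) ^+ k) * (36 / n%:R * #|cubic V|%:R))).
  apply: ler_sum => k _; rewrite /g; case: ifP => [/andP[k0 kn]|_]; last first.
    by rewrite mulr0 !mulr_ge0 ?exprn_ge0 ?invr_ge0 ?(ltW nR0) //; lra.
  rewrite big_ord_recr /= 2!mulrA.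
  rewrite (_ : _ * (36 / _ * _) = (9 / 10) ^+ k * (36 / n%:R * k%:R) * #|cubic V|%:R); last by ring.
  rewrite ler_wpM2r // ler_pM ?bin_prod_switch_ratio_le ?switch_ratio_last //.
    rewrite mulr_ge0 // prodr_ge0 // => i _; apply/ltW/switch_ratio_gt0 => //.
    exact: ltnW.
  exact/ltW/switch_ratio_gt0.
(* The constant 3240 is 36 * 90, with 90 from [sum_mul_geometric_le]. *)
rewrite -mulr_suml mulrA ler_wpM2r // (_ : 3240 / _ = 90 * (36 / n%:R)); last first.
  by field; rewrite lt0r_neq0.
by rewrite ler_wpM2r ?sum_mul_geometric_le // divr_ge0 // ltW.
Qed.

(** Each inverse ratio is at most 9 n^2 / ((2j + 1)(2j + 2)), and these denominators multiply to
    (2i)!. *)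
Lemma prod_inv_switch_ratio_le k i : (0 < k)%N -> (2 * k <= n)%N -> (i <= k)%N ->
  \prod_(j < i) (switch_ratio R n k j)^-1 <= (9 * n%:R ^+ 2) ^+ i / ((2 * i)`!)%:R.
Proof.
move=> k0 kn; elim: i => [|i IH] ik.
  by rewrite big_ord0 muln0 fact0 expr0 divr1.
have {}IH := IH (ltnW ik).
have [d1 d2] := switch_den_gt0 R k0 kn n72 (ltnW ik).
have kR : 1 <= k%:R :> R by rewrite ler1n.
have knR : 2 * k%:R <= n%:R :> R by rewrite -natrM ler_nat.
have iR : 0 <= i%:R :> R by [].
have nR' := nR.
have e1 : ((2 * i).+1)%:R = 2 * i%:R + 1 :> R by rewrite -natr1 natrM.
have e2 : ((2 * i).+2)%:R = 2 * i%:R + 2 :> R by rewrite -addn2 natrD natrM.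
rewrite big_ord_recr mulnS add2n /= exprSr !factS !natrM.
have f0 : 0 < ((2 * i)`!)%:R :> R by rewrite ltr0n fact_gt0.
rewrite [X in _ <= X](_ : _ = ((9 * n%:R ^+ 2) ^+ i / ((2 * i)`!)%:R) *
   (9 * n%:R ^+ 2 / ((2 * i%:R + 1) * (2 * i%:R + 2)))); last first.
  rewrite e1 e2; field; rewrite (lt0r_neq0 f0) !lt0r_neq0 //; lra.
apply: ler_pM => //.
- rewrite prodr_ge0 // => j _; rewrite invr_ge0; apply/ltW/switch_ratio_gt0 => //.
  exact: ltnW (ltn_trans (ltn_ord j) ik).
- by rewrite invr_ge0; apply/ltW/switch_ratio_gt0 => //; apply: ltnW.
rewrite /switch_ratio invf_div ler_wpM2r // ?invr_ge0 ?mulr_ge0 //; try lra.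
rewrite (_ : 9 * _ = (3 * n%:R) * (3 * n%:R)); last by ring.
by apply: ler_pM; lra.
Qed.

(** A chain starting from up to 2i crossing edges lacks the first i ratios. Dividing them out of the
    full product costs (9 n^2)^i / (2i)!, which n <= 2Mi and (2i)^(2i) <= 16^i (2i)! turn into (144
    M^2)^i. *)
Lemma bin_prod_switch_ratio_shift k i (M : nat) : (0 < i)%N ->
  (i <= k)%N -> (2 * k <= n)%N -> (n <= 2 * M * i)%N ->
  'C(n, k)%:R * \prod_(t < k - i) switch_ratio R n k (i + t) <=
  (9 / 10) ^+ k * (144 * M%:R ^+ 2) ^+ i.
Proof.
move=> i0 ik kn nMi; have k0 := leq_trans i0 ik.
have low0 : 0 < \prod_(j < i) switch_ratio R n k j.
  rewrite prodr_gt0 // => j _; apply: switch_ratio_gt0 => //.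
  exact: ltnW (leq_trans (ltn_ord j) ik).
have hk := bin_prod_switch_ratio_le R k0 kn n1000.
have hi := prod_inv_switch_ratio_le k0 kn ik.
have split : \prod_(j < k) switch_ratio R n k j =
   \prod_(j < i) switch_ratio R n k j * \prod_(t < k - i) switch_ratio R n k (i + t).
  rewrite -!(big_mkord xpredT) (big_cat_nat (n := i)) //=; congr (_ * _).
  rewrite -{1}[i]add0n big_addn big_mkord; apply: eq_bigr => t _; by rewrite addnC.
have hi' : \prod_(j < i) (switch_ratio R n k j)^-1 <= (144 * M%:R ^+ 2) ^+ i.
  apply: le_trans hi _; rewrite ler_pdivrMr ?ltr0n ?fact_gt0 //.
  have h1 : ((2 * i)%:R ^+ (2 * i) : R) <= 4 ^+ (2 * i) * ((2 * i)`!)%:R.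
    by rewrite -!natrX -natrM ler_nat expn_self_le.
  have nMiR : n%:R <= 2 * M%:R * i%:R :> R by rewrite -!natrM ler_nat.
  have n0 : 0 <= n%:R :> R by [].
  apply: (@le_trans _ _ ((9 * (2 * M%:R * i%:R) ^+ 2) ^+ i)).
    by rewrite lerXn2r ?nnegrE ?mulr_ge0 ?exprn_ge0 //; rewrite ler_wpM2l // lerXn2r ?nnegrE ?mulr_ge0.
  rewrite (_ : (9 * _) ^+ i = (9 * M%:R ^+ 2) ^+ i * (2 * i)%:R ^+ (2 * i)); last first.
    by rewrite exprM -exprMn natrM; congr (_ ^+ _); ring.
  apply: (@le_trans _ _ ((9 * M%:R ^+ 2) ^+ i * (4 ^+ (2 * i) * ((2 * i)`!)%:R))).
    by rewrite ler_wpM2l // exprn_ge0 // mulr_ge0 // exprn_ge0.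
  by rewrite mulrA ler_wpM2r // exprM -exprMn lerXn2r ?nnegrE ?mulr_ge0 //; lra.
rewrite split mulrCA in hk.
set Y := _ * \prod_(t < k - i) _ in hk *.
have -> : Y = \prod_(j < i) switch_ratio R n k j * Y * \prod_(j < i) (switch_ratio R n k j)^-1.
  by rewrite prodfV mulrAC mulfV ?mul1r // lt0r_neq0.
apply: ler_pM => //.
  rewrite mulr_ge0 ?(ltW low0) // mulr_ge0 // prodr_ge0 // => t _.
  apply/ltW/switch_ratio_gt0 => //; have := ltn_ord t; clear -ik; lia.
by rewrite prodfV invr_ge0 ltW.
Qed.

(** The choice of [M] keeps the loss (144 M^2)^(n/M) below (51/50)^n, while the gain (9/10)^k with k
    >= n/4 is at most (39/40)^n. The factor (n + 1)^2 counts the values of the cut size and of k. *)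
Lemma card_weak_expander_le (M : nat) : (4 <= M)%N -> (M <= n)%N ->
  144 * M%:R ^+ 2 <= (51 / 50) ^+ M :> R ->
  #|[set E in cubic V | [exists A : {set V},
      ((n <= 4 * #|A|) && (2 * #|A| <= n))%N && (M * #|cut E A| <= n)%N]]|%:R
    <= (n.+1%:R ^+ 2 * (999 / 1000) ^+ (3 * n)) * #|cubic V|%:R :> R.
Proof.
move=> M4 Mn hM; set i := (n %/ M)%N; have M0 : (0 < M)%N by apply: leq_trans M4.
have i0 : (0 < i)%N by rewrite divn_gt0.
have iMn : (M * i <= n)%N by rewrite mulnC leq_trunc_div.
have nMi : (n <= 2 * M * i)%N.
  have := ltn_ceil n M0; rewrite -/i mulSn => h; apply: ltnW; apply: leq_trans h _.
  by clear -i0; nia.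
have N0 : 0 <= #|cubic V|%:R :> R by [].
have q0 : 0 <= (999 / 1000 : R) by lra.
pose g k : R := if ((n <= 4 * k) && (2 * k <= n))%N then
   n.+1%:R * (\prod_(t < k - i) switch_ratio R n k (i + t) * #|cubic V|%:R) else 0.
apply: (@le_trans _ _ (\sum_(A : {set V}) g #|A|)).
  rewrite (le_trans (y := (\sum_(A : {set V} | ((n <= 4 * #|A|) && (2 * #|A| <= n))%N)
     #|[set E in cubic V | (M * #|cut E A| <= n)%N]|)%:R)) ?ler_nat ?card_union_bound //.
  rewrite natr_sum big_mkcond; apply: ler_sum => A _; rewrite /g.
  case: ifP => // /andP[nA An].
  have A0 : (0 < #|A|)%N by rewrite lt0n; apply/eqP => h; move: nA; rewrite h muln0 leqNgt (leq_trans _ n1000).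
  have iA : (i <= #|A|)%N.
    by rewrite -(leq_pmul2l (isT : 0 < 4)%N); apply: leq_trans nA; apply: leq_trans iMn; rewrite leq_mul2r M4 orbT.
  apply: (@le_trans _ _ (\sum_(b < n.+1 | (b <= i)%N) #|cubic_cut A b|%:R)).
    rewrite -natr_sum ler_nat -sum1_card.
    rewrite (partition_big (fun E => inord #|cut E A| : 'I_n.+1) (fun b : 'I_n.+1 => (b <= i)%N)) /=; last first.
      move=> E; rewrite inE => /andP[_ h].
      have hi : (#|cut E A| <= i)%N by rewrite leq_divRL // mulnC.
      by rewrite inordK // ltnS (leq_trans hi) // leq_div.
    apply: leq_sum => b _; rewrite sum1_card subset_leq_card //; apply/subsetP => E.
    rewrite unfold_in inE => /andP[/andP[hE h] /eqP eb]; rewrite inE hE /= -eb inordK //.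
    have hi : (#|cut E A| <= i)%N by rewrite leq_divRL // mulnC.
    by rewrite ltnS (leq_trans hi) // leq_div.
  apply: (@le_trans _ _ (\sum_(b < n.+1) \prod_(t < #|A| - i) switch_ratio R n #|A| (i + t) * #|cubic V|%:R)).
    rewrite big_mkcond; apply: ler_sum => b _; case: ifP => bi.
      apply: card_cubic_cut_chain => //; first by apply: leq_trans bi _; rewrite leq_pmull.
      by rewrite subnKC.
    rewrite mulr_ge0 // prodr_ge0 // => t _; apply/ltW/switch_ratio_gt0 => //.
    by have := ltn_ord t; clear -iA; lia.
  by rewrite sumr_const card_ord mulr_natl.
rewrite sum_over_subsets.
apply: (@le_trans _ _ (\sum_(k < n.+1) (n.+1%:R * (999 / 1000) ^+ (3 * n)) * #|cubic V|%:R)); last first.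
  by rewrite sumr_const card_ord -[X in X <= _]mulr_natl expr2 !mulrA.
apply: ler_sum => k _; rewrite /g; case: ifP => [/andP[nk kn]|_]; last first.
  by rewrite mulr0 !mulr_ge0 ?exprn_ge0.
have ik : (i <= k)%N.
  by rewrite -(leq_pmul2l (isT : 0 < 4)%N); apply: leq_trans nk; apply: leq_trans iMn; rewrite leq_mul2r M4 orbT.
rewrite mulrCA -!mulrA ler_wpM2l // mulrA ler_wpM2r //.
apply: le_trans (bin_prod_switch_ratio_shift i0 ik kn nMi) _.
apply: (@le_trans _ _ ((39 / 40) ^+ n * (51 / 50) ^+ n)).
  apply: ler_pM; rewrite ?exprn_ge0 ?mulr_ge0 ?exprn_ge0 //; try lra.
    apply: (@le_trans _ _ ((39 / 40) ^+ (4 * k))).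
      by rewrite exprM lerXn2r ?nnegrE ?exprn_ge0 //; lra.
    by rewrite ler_wiXn2l //; lra.
  apply: (@le_trans _ _ ((51 / 50) ^+ (M * i))).
    by rewrite exprM lerXn2r ?nnegrE ?exprn_ge0 ?mulr_ge0 ?exprn_ge0 //; lra.
  by rewrite ler_weXn2l //; lra.
(* Numerically, 39/40 * 51/50 < (999/1000)^3. *)
by rewrite -exprMn exprM lerXn2r ?nnegrE ?exprn_ge0 ?mulr_ge0 //; lra.
Qed.

End Events.

(** * Random cubic graphs *)

(* The circulant graph on Z/2h with jumps 1 and h. *)
Lemma cubic_exists n : ~~ odd n -> (4 <= n)%N -> (0 < #|cubic 'I_n|)%N.
Proof.
case: n => // p; set n := p.+1 => oddn n4.
pose h := n./2; have nh : n = h.*2 by rewrite -[LHS]odd_double_half (negbTE oddn).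
have h2 : (2 <= h)%N by rewrite -leq_double -nh.
pose one : 'I_n := inZp 1; pose half : 'I_n := inZp h.
have hn : (h < n)%N by rewrite nh -addnn -addn1 leq_add2l ltnW.
have v1 : val one = 1%N by rewrite /= modn_small // (leq_trans _ n4).
have vh : val half = h by rewrite /= modn_small.
have hh : half + half = 0 by apply/val_inj; rewrite /= modnDmr modnDml addnn -nh modnn.
have halfN : - half = half by apply/eqP; rewrite eq_sym -addr_eq0 hh.
have one0 : one != 0 by rewrite -val_eqE v1.
have half0 : half != 0 by rewrite -val_eqE vh /= -lt0n ltnW.
have one1 : one + one != 0 by rewrite -val_eqE /= modnDmr modnDml modn_small // (leq_trans _ n4).
have onehalf : one != half by rewrite -val_eqE v1 vh neq_ltn h2.
have onehalf0 : one + half != 0.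
  rewrite -val_eqE /= modnDmr modnDml modn_small // -/n nh -addnn.
  by rewrite ltn_add2r.
pose E : {set {set 'I_n}} := [set [set x; x + d] | x in [set: 'I_n], d in [set one; half]].
have gE : graphic E.
  apply/forall_inP => e /imset2P[x d _ hd ->]; rewrite cards2.
  rewrite (_ : x != x + d) //; rewrite -[X in X != _]addr0 (inj_eq (addrI x)) eq_sym.
  by move: hd; rewrite !inE => /orP[]/eqP->.
have nbhdE x : nbhd E x = x + one |: [set x - one; x + half].
  apply/setP => y; rewrite inE; apply/imset2P/idP => [[z d _]|].
    rewrite !inE => /orP[]/eqP-> /set2_inj[][-> ->]; rewrite ?eqxx ?orbT ?addrK ?eqxx ?orbT //.
    by have -> : z + half + half = z by [rewrite -addrA hh addr0]; rewrite eqxx !orbT.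
  rewrite !inE => /or3P[]/eqP->.
  - by exists x one; rewrite ?inE ?eqxx.
  - by exists (x - one) one; rewrite ?inE ?eqxx // subrK setUC.
  - by exists x half; rewrite ?inE ?eqxx ?orbT.
apply/card_gt0P; exists E; rewrite inE gE /=; apply/forallP => x.
rewrite -card_nbhd_incident // nbhdE cardsU1 cards2 !inE !(inj_eq (addrI x)).
have -> : (one == - one) = false by apply/negbTE; rewrite -addr_eq0.
have -> : (- one == half) = false by apply/negbTE; rewrite eq_sym -addr_eq0 addrC.
by rewrite (negbTE onehalf).
Qed.

Lemma card_regular_graphs3 n (P : pred (graph 'I_n)) :
  #|[set G in regular_graphs n 3 | P G]| = #|[set E in cubic 'I_n | P ([set: 'I_n], E)]|.
Proof.
pose f (E : {set {set 'I_n}}) : graph 'I_n := ([set: 'I_n], E).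
have f_inj : injective f by move=> E F [].
rewrite -(card_imset _ f_inj); apply: eq_card => -[W E]; rewrite inE.
have regE F : (f F \in regular_graphs n 3) = (F \in cubic 'I_n).
  rewrite !inE /= eqxx /=; congr (_ && _).
    by apply: eq_forallb => e; rewrite subsetT andbT.
  by apply: eq_forallb => v; rewrite inE.
apply/andP/imsetP => [[hG PG]|[F hF ->]]; last first.
  by move: hF; rewrite regE inE => /andP[].
have /and3P[_ /eqP eW _] : [&& simple_graph (W, E), verts (W, E) == [set: 'I_n] &
    regular_graph 3 (W, E)] by move: hG; rewrite inE.
move: hG PG; rewrite /verts /= in eW; rewrite eW => hG PG.
by exists E => //; rewrite inE -regE hG.
Qed.

Lemma mul_geometric_le (R : realFieldType) n :
  n.+1%:R * (999 / 1000) ^+ n <= 999 :> R.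
Proof.
(* Strengthened so that the bound is decreasing in m: 999/1000 * (1000 + m) <= 999 + m. *)
have h m : (999 + m%:R) * (999 / 1000) ^+ m <= 999 :> R.
  elim: m => [|m IH]; first by rewrite expr0; lra.
  apply: le_trans IH; rewrite exprS mulrA ler_wpM2r ?exprn_ge0 //; first by lra.
  by have m0 : 0 <= m%:R :> R by []; rewrite -natr1; lra.
apply: le_trans (h n); rewrite ler_wpM2r ?exprn_ge0 //; first by lra.
by rewrite -natr1; lra.
Qed.

Lemma square_le_geometric (R : archiRealFieldType) :
  exists2 M : nat, (4 <= M)%N & 144 * M%:R ^+ 2 <= (51 / 50) ^+ M :> R.
Proof.
(* For M = 3m, Bernoulli's inequality gives (51/50)^M >= (1 + m/50)^3. With z = m/50, the left side
   is 1800^2 z^2, so z >= 1800^2 suffices. *)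
pose c : R := 50 * 1800 ^+ 2.
have c0 : 0 <= c by rewrite mulr_ge0 ?exprn_ge0.
pose m := (Num.bound c).+2.
have hm : c <= m%:R.
  by apply: le_trans (ltW (archi_boundP c0)) _; rewrite ler_nat leqW.
exists (m * 3)%N; first by rewrite (@leq_trans (2 * 3)%N) // leq_mul2r.
have h : 1 + m%:R / 50 <= (51 / 50) ^+ m :> R.
  elim: (m) => [|i IH]; first by rewrite expr0; lra.
  have i0 : 0 <= i%:R :> R by [].
  by rewrite exprS -natr1; lra.
move: hm h; rewrite exprM natrM /c; move: (m%:R) (_ ^+ m) => {c c0 m} x y hx xy.
have x0 : 0 <= x by apply: le_trans hx; rewrite mulr_ge0 ?exprn_ge0.
apply: (@le_trans _ _ ((1 + x / 50) ^+ 3)); last by rewrite lerXn2r ?nnegrE //; lra.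
pose z := x / 50.
have z0 : 0 <= z by rewrite divr_ge0.
have hz : 1800 ^+ 2 <= z by rewrite ler_pdivlMr // mulrC.
have -> : 144 * (x * 3) ^+ 2 = 1800 ^+ 2 * z ^+ 2 by rewrite /z; field.
rewrite -/z; apply: (@le_trans _ _ (z * z ^+ 2)); first by rewrite ler_wpM2r ?exprn_ge0.
by rewrite -exprS lerXn2r ?nnegrE ?addr_ge0 // lerDr.
Qed.

Section GoodGraphs.
Variables (R : realFieldType) (n M : nat).
Hypotheses (M4 : (4 <= M)%N) (hM : 144 * M%:R ^+ 2 <= (51 / 50) ^+ M :> R).
Let L := (100 * M)%N.
Hypotheses (n1000 : (1000 <= n)%N) (nL : (30 * L <= n)%N).

Lemma card_low_discrepancy_le :
  #|[set E in cubic 'I_n |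
     (L * discrepancy ([set: 'I_n], E) (spanning_trees ([set: 'I_n], E)) < n)%N]|%:R
  <= (3240 + 999 ^+ 3 + (L * (L.+1 * (L.+2 * (12 * L ^ 2) ^ L)))%:R) / n%:R * #|cubic 'I_n|%:R :> R.
Proof.
set K := (L * _)%N; have M0 : (0 < M)%N by apply: leq_trans M4.
have n0 : (0 < n)%N by apply: leq_trans n1000.
have nR : 0 < n%:R :> R by rewrite ltr0n.
have Mn : (M <= n)%N by apply: leq_trans nL; rewrite /L mulnA leq_pmull.
set B1 := [set E in cubic 'I_n | [exists A : {set 'I_n},
      ((0 < #|A|) && (2 * #|A| <= n))%N && (cut E A == set0)]].
set B2 := [set E in cubic 'I_n | (n < L * #|small_boundary E L|)%N].
set B3 := [set E in cubic 'I_n | [exists A : {set 'I_n},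
      ((n <= 4 * #|A|) && (2 * #|A| <= n))%N && (M * #|cut E A| <= n)%N]].
set B := [set E in _ | _].
have cn := card_ord n.
have b1 : #|B1|%:R <= 3240 / n%:R * #|cubic 'I_n|%:R :> R.
  by have := @card_disconnected_le R 'I_n; rewrite !cn; apply.
have b3 : #|B3|%:R <= (n.+1%:R ^+ 2 * (999 / 1000) ^+ (3 * n)) * #|cubic 'I_n|%:R :> R.
  by have := @card_weak_expander_le R 'I_n; rewrite !cn; apply.
have b2 : #|B2|%:R <= K%:R / n%:R * #|cubic 'I_n|%:R :> R.
  rewrite mulrAC ler_pdivlMr // -!natrM ler_nat.
  by have := @card_many_small_le 'I_n L; rewrite !cn; apply.
have b3' : n.+1%:R ^+ 2 * (999 / 1000) ^+ (3 * n) <= 999 ^+ 3 / n%:R :> R.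
  rewrite ler_pdivlMr //; set r : R := 999 / 1000.
  have r0 : 0 <= r by rewrite divr_ge0.
  (* Two factors n + 1 and the n moved from the denominator are each absorbed by one of the three
     powers [r ^+ n]. *)
  apply: (@le_trans _ _ ((n.+1%:R * r ^+ n) ^+ 3)).
    rewrite [X in _ <= X]exprMn -exprM [(n * 3)%N]mulnC mulrAC ler_wpM2r ?exprn_ge0 //.
    by rewrite [X in _ <= X]exprSr ler_wpM2l ?exprn_ge0 // ler_nat.
  by rewrite lerXn2r ?nnegrE ?mulr_ge0 ?exprn_ge0 ?mul_geometric_le.
(* Outside the three bad events, all hypotheses of [discrepancy_ge] hold. *)
have sub : B \subset B1 :|: B2 :|: B3.
  apply/subsetP => E; rewrite inE => /andP[hE hD].
  apply: contraLR hD; rewrite !in_setU [E \in B1]inE [E \in B2]inE [E \in B3]inE hE /= !negb_or -leqNgt => /andP[/andP[h1 h2] h3].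
  have := @discrepancy_ge 'I_n E L M hE; rewrite !cn -leqNgt.
  apply=> // [A A0 An|A An nA].
  - apply: contra h1 => cA; apply/existsP; exists A; rewrite cA An.
    by rewrite card_gt0 A0.
  rewrite ltnNge; apply: contra h3 => cA; apply/existsP; exists A.
  by rewrite An nA.
have cB : (#|B| <= #|B1| + #|B2| + #|B3|)%N.
  apply: leq_trans (subset_leq_card sub) _; apply: leq_trans (leq_card_setU _ _) _.
  by rewrite leq_add2r leq_card_setU.
have N0 : 0 <= #|cubic 'I_n|%:R :> R by [].
move: cB; rewrite -(ler_nat R) !natrD => cB; apply: le_trans cB _.
have {}b3 := le_trans b3 (ler_wpM2r N0 b3').
by have h := lerD (lerD b1 b3) b2; rewrite -!mulrDl addrAC in h.
Qed.

End GoodGraphs.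

Lemma uniform_prob_regular_graphs3 (R : realFieldType) n (P : pred (graph 'I_n)) (x : R) :
  (0 < #|cubic 'I_n|)%N ->
  #|[set E in cubic 'I_n | ~~ P ([set: 'I_n], E)]|%:R <= x * #|cubic 'I_n|%:R ->
  1 - x <= uniform_prob_of R (regular_graphs n 3) P <= 1.
Proof.
move=> N0 hx; rewrite /uniform_prob_of card_regular_graphs3.
have -> : #|regular_graphs n 3| = #|cubic 'I_n|.
  transitivity #|[set G in regular_graphs n 3 | predT G]|.
    by apply: eq_card => G; rewrite [RHS]inE andbT.
  by rewrite card_regular_graphs3; apply: eq_card => E; rewrite [LHS]inE andbT.
have NR : 0 < #|cubic 'I_n|%:R :> R by rewrite ltr0n.
rewrite ler_pdivlMr // ler_pdivrMr // mul1r ler_nat; apply/andP; split; last first.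
  by apply: subset_leq_card; apply/subsetP => E; rewrite [_ \in [set _ | _]]inE => /andP[].
have cN : #|cubic 'I_n| = (#|[set E in cubic 'I_n | P ([set: 'I_n], E)]| +
    #|[set E in cubic 'I_n | ~~ P ([set: 'I_n], E)]|)%N.
  rewrite -(cardsID [set E | P ([set: 'I_n], E)] (cubic 'I_n)).
  by congr (_ + _)%N; apply: eq_card => E; rewrite [RHS]inE !inE // andbC.
by rewrite mulrBl mul1r lerBlDr {1}cN natrD lerD2l.
Qed.

Lemma discrepancy_regular_graphs3 (R : archiRealFieldType) :
  exists c K : R, exists2 N : nat, 0 < c & forall n, (N <= n)%N -> ~~ odd n ->
    1 - K / n%:R <= uniform_prob_of R (regular_graphs n 3)
      (fun G => c * n%:R <= (discrepancy G (spanning_trees G))%:R) <= 1.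
Proof.
have [M M4 hM] := square_le_geometric R.
set L := (100 * M)%N.
exists L%:R^-1, (3240 + 999 ^+ 3 + (L * (L.+1 * (L.+2 * (12 * L ^ 2) ^ L)))%:R).
exists (maxn 1000 (30 * L)).
  by rewrite invr_gt0 ltr0n muln_gt0 (leq_trans _ M4).
move=> n; rewrite geq_max => /andP[n1000 nL] nodd.
apply: uniform_prob_regular_graphs3.
  by apply: cubic_exists => //; apply: leq_trans n1000.
apply: le_trans (card_low_discrepancy_le M4 hM n1000 nL).
rewrite ler_nat subset_leq_card //; apply/subsetP => E.
rewrite ![_ \in [set _ | _]]inE => /andP[-> /=]; rewrite -/L.
rewrite -ltNge mulrC ltr_pdivlMr; last by rewrite ltr0n muln_gt0 (leq_trans _ M4).
by rewrite mulrC -natrM ltr_nat.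
Qed.

(* The limit along even n *)
From mathcomp Require Import all_classical all_reals all_analysis.

Import Order.TTheory GRing.Theory Num.Theory.
Import numFieldNormedType.Exports.
Local Open Scope classical_set_scope.
Local Open Scope ring_scope.

Theorem theorem1p3 (R : realType) :
  exists2 c : R, 0 < c &
    uniform_prob_of R (regular_graphs n 3)
      (fun G => c * n%:R <= (discrepancy G (spanning_trees G))%:R)
    @[n --> within [set n : nat | ~~ odd n] \oo] --> (1 : R).
Proof.
have [c [K [N c0 hN]]] := discrepancy_regular_graphs3 R.
exists c => //.
apply: (@squeeze_cvgr _ _ _ _ (fun n : nat => 1 - K / n%:R) (fun=> 1)).
- by exists N => // n /= Nn /= nodd; apply: hN.
- apply: cvg_trans (_ : (1 - K / n%:R @[n --> \oo] --> (1 : R))).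
    exact/cvg_app/cvg_within.
  rewrite -[X in _ --> X]subr0; apply: cvgB; first exact: cvg_cst.
  rewrite -(mulr0 K); apply: cvgM; first exact: cvg_cst.
  have pos : \forall n \near \oo, 0 < (n%:R : R).
    by exists 1%N => // n /= n0; rewrite ltr0n.
  exact: (gtr0_cvgV0 pos).2 cvgr_idn.
exact: cvg_cst.
Qed.
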